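(* Let $B$ be a central simple algebra over a number field $K$ of dimension $n^2\ge 4$, and let $L$ be a degree $n$ field extension of $K$ which is contained in $B$. Let $\nu$ be a finite place of $K$ which splits or is partially ramified in $B$, so $B_\nu\cong M_{r_\nu}(D_\nu)$ with $r_\nu>1$ and $D_\nu$ a central division algebra over $K_\nu$ of degree $m_\nu$. Assume that $\nu$ is unramified in $L$, and let $\{\mathfrak P_1,\dots,\mathfrak P_g\}$ be the set of places of $L$ lying above $\nu$. Let $r_{\mathfrak P_i}=[L_{\mathfrak P_i}:K_\nu]/m_\nu$. Identify $B_\nu$ with $M_{r_\nu}(D_\nu)$ in the block-compatible way described in the context. Then $\mathcal O_L$ is contained in the maximal order of $B_\nu$ represented by the homothety class $[\mathcal L]=[a_1,\dots,a_{r_\nu}]\in\mathbb Z^{r_\nu}/\mathbb Z(1,\dots,1)$ if and only if there are $\ell_1,\dots,\ell_g\in\mathbb Z$ such that $$[\mathcal L]=[\underbrace{\ell_1,\dots,\ell_1}_{r_{\mathfrak P_1}},\underbrace{\ell_2,\dots,\ell_2}_{r_{\mathfrak P_2}},\dots,\underbrace{\ell_g,\dots,\ell_g}_{r_{\mathfrak P_g}}].$$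
   Context: $\mathcal O_K,\mathcal O_L$ are the rings of integers; for a finite place $\nu$ of $K$, $\mathcal O_\nu$ is the valuation ring of $K_\nu$, and $\mathcal O_{\mathfrak P}$ that of $L_{\mathfrak P}$. $B_\nu=K_\nu\otimes_K B\cong M_{r_\nu}(D_\nu)$ with $D_\nu$ a central division $K_\nu$-algebra of degree $m_\nu$ and $n=r_\nu m_\nu$. The place $\nu$ splits in $B$ if $m_\nu=1$, totally ramifies if $m_\nu=n$, partially ramifies if $1<m_\nu<n$. $\Delta_\nu$ is the unique maximal order of $D_\nu$ and $\boldsymbol\pi$ a fixed uniformizer of $\Delta_\nu$. Since $L\subset B$, $m_\nu\mid[L_{\mathfrak P}:K_\nu]$ for every $\mathfrak P\mid\nu$, so $r_{\mathfrak P}=[L_{\mathfrak P}:K_\nu]/m_\nu$ is a positive integer, and $\sum_{\mathfrak P\mid\nu}r_{\mathfrak P}=r_\nu$. Fix a maximal $\mathcal O_K$-order $\mathcal R$ of $B$ containing $\mathcal O_L$, and put $\mathcal R_\nu=\mathcal O_\nu\otimes_{\mathcal O_K}\mathcal R$. Block-compatible identification: $B_\nu$ is identified with $M_{r_\nu}(D_\nu)$ so that $\mathcal R_\nu=M_{r_\nu}(\Delta_\nu)$ and so that the embedding $K_\nu\otimes_K L\cong\bigoplus_{i=1}^g L_{\mathfrak P_i}\hookrightarrow B_\nu$ is block diagonal: $L_{\mathfrak P_i}$ maps into the $i$-th diagonal block $M_{r_{\mathfrak P_i}}(D_\nu)$ with $\mathcal O_{\mathfrak P_i}$ mapping into $M_{r_{\mathfrak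 P_i}}(\Delta_\nu)$. $\mathcal O_L$ is identified with the image of $1\otimes\mathcal O_L$ in $B_\nu$. With respect to the corresponding basis of $D_\nu^{r_\nu}$ (which determines an apartment of the affine building of $SL_{r_\nu}(D_\nu)$), the class $[a_1,\dots,a_{r_\nu}]\in\mathbb Z^{r_\nu}/\mathbb Z(1,\dots,1)$ represents the maximal order $$\operatorname{diag}(\boldsymbol\pi^{a_1},\dots,\boldsymbol\pi^{a_{r_\nu}})\,M_{r_\nu}(\Delta_\nu)\,\operatorname{diag}(\boldsymbol\pi^{a_1},\dots,\boldsymbol\pi^{a_{r_\nu}})^{-1},$$ i.e. the endomorphism ring of the homothety class of the $\Delta_\nu$-lattice $\bigoplus_i\Delta_\nu\boldsymbol\pi^{a_i}\alpha_i$, where $\{\alpha_i\}$ is the chosen basis. *)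

(* Defs.v *)
From HB Require Import structures.
From mathcomp Require Import all_boot all_order all_algebra all_field.
From mathcomp Require Import classical_sets.

Set Implicit Arguments.
Unset Strict Implicit.
Unset Printing Implicit Defensive.

Import Order.TTheory GRing.Theory Num.Theory.

Local Open Scope classical_set_scope.
Local Open Scope ring_scope.

Definition ring_of_integers (F : fieldType) : set F :=
  [set x | integralOver (intr : int -> F) x].

(* Valuations take values in int; v 0 stands for +oo, so its actual value is
   never used. *)
Definition val_ge (F : fieldType) (v : F -> int) (N : int) (x : F) : Prop :=
  x != 0 -> N <= v x.

(* Normalized discrete valuations: the finite places of a number field. *)
Record discrete_valuation (F : fieldType) (v : F -> int) : Prop := {
  valM : forall x y, x != 0 -> y != 0 -> v (x * y) = v x + v y;
  valD : forall N x y, val_ge v N x -> val_ge v N y -> val_ge v N (x + y);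
  val_surj : exists2 x, x != 0 & v x = 1 }.

Definition valuation_ring (F : fieldType) (v : F -> int) : set F :=
  [set x | val_ge v 0 x].

(* (E, iota, u) is a completion of (F, v). *)
Record is_completion (F E : fieldType) (v : F -> int)
    (iota : {rmorphism F -> E}) (u : E -> int) : Prop := {
  completion_val : discrete_valuation u;
  completion_ext : forall x, x != 0 -> u (iota x) = v x;
  completion_dense : forall (y : E) (N : int),
    exists x : F, val_ge u N (y - iota x);
  completion_complete : forall s : nat -> E,
    (forall N : int, exists n0 : nat, forall p q : nat,
       (n0 <= p)%N -> (n0 <= q)%N -> val_ge u N (s p - s q)) ->
    exists l : E, forall N : int, exists n0 : nat, forall p : nat,
      (n0 <= p)%N -> val_ge u N (s p - l) }.

Definition ramification_index (F : fieldType) (E : fieldExtType F)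
    (v : F -> int) (w : E -> int) (e : nat) : Prop :=
  (0 < e)%N /\ forall c : F, c != 0 -> w (c%:A) = e%:Z * v c.

Definition lies_above (F : fieldType) (E : fieldExtType F)
    (v : F -> int) (w : E -> int) : Prop :=
  exists e, ramification_index v w e.

Definition enumerates_places_above (F : fieldType) (E : fieldExtType F)
    (v : F -> int) (g : nat) (w : 'I_g -> E -> int) : Prop :=
  [/\ forall i, discrete_valuation (w i) /\ lies_above v (w i),
      forall i j, (forall x, x != 0 -> w i x = w j x) -> i = j
    & forall w', discrete_valuation w' -> lies_above v w' ->
        exists i, forall x, x != 0 -> w i x = w' x].

(* Residue fields being finite, no separability condition is needed. *)
Definition unramified_in (F : fieldType) (E : fieldExtType F)
    (v : F -> int) : Prop :=
  forall w : E -> int, discrete_valuation w -> lies_above v w ->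
    ramification_index v w 1.

Definition central (F : fieldType) (A : falgType F) : Prop :=
  ('Z({:A}) = 1)%VS.

(* Two-sided ideals of a unital algebra are subspaces. *)
Definition simple (F : fieldType) (A : falgType F) : Prop :=
  forall I : {vspace A},
    ({:A} * I <= I)%VS -> (I * {:A} <= I)%VS -> I = 0%VS \/ I = fullv.

Definition division (F : fieldType) (A : falgType F) : Prop :=
  forall x : A, x != 0 -> x \is a GRing.unit.

Definition module_span (R : nzRingType) (V : lmodType R) (O : set R)
    (S : set V) : set V :=
  [set x | exists (k : nat) (c : 'I_k -> R) (s : 'I_k -> V),
     [/\ forall i, O (c i), forall i, S (s i) & x = \sum_i c i *: s i]].

(* O-orders of A, for O a subring of F. *)
Record is_order (F : fieldType) (O : set F) (A : falgType F) (R : set A) :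
    Prop := {
  order1 : R 1;
  orderB : forall x y, R x -> R y -> R (x - y);
  orderM : forall x y, R x -> R y -> R (x * y);
  order_fg : exists s : seq A, R = module_span O [set` s];
  order_full : module_span setT R = setT }.

Definition maximal_order (F : fieldType) (O : set F) (A : falgType F)
    (R : set A) : Prop :=
  is_order O R /\ forall R', is_order O R' -> R `<=` R' -> R' = R.

(* The non-units of the local ring Delta form its maximal ideal, which pi
   generates on either side. *)
Definition is_uniformizer (D : unitRingType) (Delta : set D) (pi : D) : Prop :=
  let unitD := [set x | [/\ x \is a GRing.unit, Delta x & Delta x^-1]] in
  Delta `\` unitD = [set pi * x | x in Delta] /\
  Delta `\` unitD = [set x * pi | x in Delta].

(* phi : B -> M_r(D) exhibits M_r(D) as E (x)_F B: it is an F-algebra morphism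
   whose E-linear extension E (x)_F B -> M_r(D) is bijective. E acts on M_r(D)
   through the scalars of D, as MathComp only makes M_r(D) a D-module. *)
Definition is_base_change (F E : fieldType) (iota : {rmorphism F -> E})
    (B : falgType F) (D : falgType E) (r : nat)
    (phi : {rmorphism B -> 'M[D]_r}) : Prop :=
  (forall (c : F) (x : B), phi (c *: x) = (iota c)%:A *: phi x) /\
  (forall X : (\dim {:B}).-tuple B, basis_of fullv X ->
     forall M : 'M[D]_r, exists! c : {ffun 'I_(\dim {:B}) -> E},
       M = \sum_k (c k)%:A *: phi (tnth X k)).

Definition matrices_over (D : nzRingType) (m n : nat) (Delta : set D) :
    set 'M[D]_(m, n) :=
  [set M | forall i j, Delta (M i j)].
Arguments matrices_over {D} m n Delta.

(* The image of O (x) R in M_r(D), for R a subset of B. *)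
Definition localized_order (E : fieldType) (D : falgType E) (r : nat)
    (T : Type) (O : set E) (phi : T -> 'M[D]_r) (R : set T) : set 'M[D]_r :=
  module_span (in_alg D @` O) (phi @` R).

Definition block_sizes (F : fieldType) (g : nat) (LP : 'I_g -> fieldExtType F)
    (m : nat) (i : 'I_g) : nat :=
  (\dim {: LP i} %/ m)%N.

(* The algebra phi : B -> M_r(D), with r the sum of the r_i, is identified so
   that R becomes M_r(Delta) and the i-th factor LP i of E (x)_F L is carried
   into the i-th diagonal block, its valuation ring having entries in Delta. *)
Definition block_compatible (E : fieldType) (vE : E -> int) (D : falgType E)
    (Delta : set D) (L : fieldType) (B : nzRingType) (sigma : L -> B)
    (R : set B) (g : nat) (LP : 'I_g -> fieldExtType E)
    (wP : forall i, LP i -> int) (j : forall i, L -> LP i)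
    (r_ : 'I_g -> nat) (phi : B -> 'M[D]_(\sum_i r_ i)) : Prop :=
  localized_order (valuation_ring vE) phi R = matrices_over _ _ Delta /\
  exists psi : forall i, {rmorphism LP i -> 'M[D]_(r_ i)},
    [/\ forall i (c : E) (x : LP i), psi i (c *: x) = c%:A *: psi i x,
        forall l : L, phi (sigma l) = \mxdiag_(i < g) psi i (j i l)
      & forall i, psi i @` valuation_ring (@wP i)
                    `<=` matrices_over _ _ Delta].

(* diag(pi^a_1, ..., pi^a_r) M_r(Delta) diag(pi^a_1, ..., pi^a_r)^-1 *)
Definition vertex_order (D : unitRingType) (r : nat) (Delta : set D) (pi : D)
    (a : 'rV[int]_r) : set 'M[D]_r :=
  [set diag_mx (\row_k (pi ^ a 0 k)) *m X *m diag_mx (\row_k (pi ^ (- a 0 k)))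
     | X in matrices_over r r Delta].

(* The coset of a in Z^r / Z(1, ..., 1). *)
Definition homothety_class (r : nat) (a : 'rV[int]_r) : set 'rV[int]_r :=
  [set a + const_mx c | c in [set: int]].

(* Main.v *)
(* Membership of [phi (sigma x)] in the vertex order [a] bounds the valuation of
   its (s, t) entry below by a_s - a_t; when [a] is constant on the blocks this
   holds because conjugation by [pi] preserves [Delta].

   Conversely, suppose [a] is not constant on the block of a place P, of size r,
   and let S be the proper subset of indices where [a] is maximal. The entries
   (s, u) with s in S and u not in S are then in the maximal ideal of [Delta] for
   every x in O_L, hence for every x in O_P since O_L maps onto the residue field
   k_P. Fix t in S. If the entries (s, t), s in S, of two elements x, x' of O_P
   agree modulo the maximal ideal and z = x - x' is a unit of O_P, then
   1 = psi(z^-1) psi(z) has its (t, t) entry in the maximal ideal, which is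
   absurd. So k_P injects into a product of #|S| < r copies of the residue ring
   of [Delta]. Let q be the order of the residue field of K_nu. As L_P is
   unramified over the complete field K_nu, k_P has at least q^(r m) elements;
   and the residue ring of [Delta] has at most q^m elements: by Wedderburn's
   theorem it is a finite field, generated by one element, and every element of
   D satisfies a polynomial of degree m over K_nu. *)

Require Import Defs.
From HB Require Import structures.
From mathcomp Require Import all_boot all_order all_algebra all_field.
From mathcomp Require Import fingroup cyclic boolp classical_sets.
From mathcomp Require Import zify.

Set Implicit Arguments.
Unset Strict Implicit.
Unset Printing Implicit Defensive.

Import Order.TTheory GRing.Theory Num.Theory.

Local Open Scope classical_set_scope.
Local Open Scope ring_scope.

(** * Valuations *)

Definition subgroup (V : zmodType) (M : set V) : Prop :=
  M 0 /\ forall x y, M x -> M y -> M (x - y).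

Section Subgroup.
Variables (V : zmodType) (M : set V).
Hypothesis M_sub : subgroup M.

Lemma subgroup0 : M 0. Proof. exact: M_sub.1. Qed.

Lemma subgroupB x y : M x -> M y -> M (x - y). Proof. exact: M_sub.2. Qed.

Lemma subgroupN x : M x -> M (- x).
Proof. by move=> Mx; rewrite -sub0r; apply: subgroupB; first exact: subgroup0. Qed.

Lemma subgroupD x y : M x -> M y -> M (x + y).
Proof. by move=> Mx My; rewrite -[y]opprK; apply/subgroupB/subgroupN. Qed.

Lemma subgroup_sum (I : finType) (P : pred I) (f : I -> V) :
  (forall i, P i -> M (f i)) -> M (\sum_(i | P i) f i).
Proof. by move=> Mf; elim/big_ind: _ => //; [exact: subgroup0 | exact: subgroupD]. Qed.

Lemma subgroup_trans y x z : M (x - y) -> M (y - z) -> M (x - z).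
Proof. by move=> Mxy Myz; rewrite -(subrKA y); apply: subgroupD. Qed.

Lemma subgroup_sym x y : M (x - y) -> M (y - x).
Proof. by move=> Mxy; rewrite -opprB; apply: subgroupN. Qed.

End Subgroup.

(* Valuations that may be trivial or not normalized, such as the restriction
   of a place to a subfield. *)
Definition is_valuation (F : fieldType) (v : F -> int) : Prop :=
  (forall x y, x != 0 -> y != 0 -> v (x * y) = v x + v y) /\
  (forall N x y, val_ge v N x -> val_ge v N y -> val_ge v N (x + y)).

Lemma discrete_is_valuation (F : fieldType) (v : F -> int) :
  discrete_valuation v -> is_valuation v.
Proof. by case. Qed.

Section Valuation.
Variables (F : fieldType) (v : F -> int).
Hypothesis v_val : is_valuation v.

Lemma val1 : v 1 = 0.
Proof.
have := v_val.1 1 1 (oner_neq0 F) (oner_neq0 F).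
by rewrite mulr1 => /eqP; rewrite -subr_eq0 opprD addNKr oppr_eq0 => /eqP.
Qed.

Lemma valV x : x != 0 -> v x^-1 = - v x.
Proof.
move=> x0; have := v_val.1 x x^-1 x0; rewrite invr_eq0 => /(_ x0).
by rewrite divff // val1 => /esym/eqP; rewrite addrC addr_eq0 => /eqP.
Qed.

Lemma valX x k : x != 0 -> v (x ^+ k) = v x *+ k.
Proof.
move=> x0; elim: k => [|k IHk]; first by rewrite expr0 val1.
by rewrite exprS v_val.1 ?expf_neq0 // IHk mulrS.
Qed.

Lemma val_ge0 N : val_ge v N 0. Proof. by rewrite /val_ge eqxx. Qed.

Lemma val_geW M N x : M <= N -> val_ge v N x -> val_ge v M x.
Proof. by move=> leMN vx x0; apply: le_trans leMN (vx x0). Qed.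

Lemma val_geM M N x y : val_ge v M x -> val_ge v N y -> val_ge v (M + N) (x * y).
Proof.
move=> vx vy; rewrite /val_ge mulf_eq0 negb_or => /andP[x0 y0].
by rewrite v_val.1 // lerD ?vx ?vy.
Qed.

Lemma val_ge_1 : val_ge v 0 1. Proof. by rewrite /val_ge val1. Qed.

Lemma val_geN N x : val_ge v N x -> val_ge v N (- x).
Proof.
move=> vx; rewrite -mulN1r -[N]add0r; apply: val_geM => //.
(* [v (-1)] is zero because twice it is [v 1]. *)
have /eqP : v ((-1) ^+ 2) = 0 by rewrite sqrrN expr1n val1.
by rewrite valX ?oppr_eq0 ?oner_eq0 // mulrn_eq0 /= => /eqP vN1 _; rewrite vN1.
Qed.

Lemma val_ge_subgroup N : subgroup (val_ge v N).
Proof.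
split=> [|x y vx vy]; first exact: val_ge0.
by apply: v_val.2 => //; apply: val_geN.
Qed.

Lemma val_geMl N x y : val_ge v 0 x -> val_ge v N y -> val_ge v N (x * y).
Proof. by move=> vx vy; rewrite -[N]add0r; apply: val_geM. Qed.

Lemma val_geMr N x y : val_ge v N x -> val_ge v 0 y -> val_ge v N (x * y).
Proof. by move=> vx vy; rewrite -[N]addr0; apply: val_geM. Qed.

Lemma val_geX x k : val_ge v 0 x -> val_ge v 0 (x ^+ k).
Proof.
by move=> vx; elim: k => [|k IHk]; [exact: val_ge_1 | rewrite exprS; apply: val_geMl].
Qed.

Lemma not_val_ge1 x : val_ge v 0 x -> ~ val_ge v 1 x -> x != 0 /\ v x = 0.
Proof.
move=> vx Nvx; have x0 : x != 0 by apply/eqP=> x0; apply: Nvx; rewrite x0; apply: val_ge0.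
split=> //; have := vx x0; rewrite le_eqVlt => /orP[/eqP <- //|v_gt0].
by case: Nvx => _.
Qed.

Lemma val_eq0_not_ge1 x : x != 0 -> v x = 0 -> ~ val_ge v 1 x.
Proof. by move=> x0 vx /(_ x0); rewrite vx. Qed.

Lemma not_val_ge1_1 : ~ val_ge v 1 1.
Proof. by apply: val_eq0_not_ge1; rewrite ?oner_eq0 // val1. Qed.

Lemma val_ge0V x : x != 0 -> v x = 0 -> val_ge v 0 x^-1.
Proof. by move=> x0 vx _; rewrite valV // vx. Qed.

(** Dividing by a nonzero entry of least valuation makes all entries integral and that one equal to
    1. *)
Lemma primitive_scaling k (c : 'I_k -> F) : (exists i, c i != 0) ->
  exists2 a, a != 0 &
    (forall i, val_ge v 0 (a * c i)) /\ exists i, ~ val_ge v 1 (a * c i).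
Proof.
move=> [i0 ci0].
case: (@arg_minP _ _ _ i0 (fun i => c i != 0) (fun i => v (c i)) ci0) => /= i ci min_i.
exists (c i)^-1; rewrite ?invr_eq0 //; split=> [l|].
  rewrite /val_ge mulf_eq0 invr_eq0 negb_or => /andP[_ cl].
  by rewrite v_val.1 ?invr_eq0 // valV // addrC subr_ge0 min_i.
by exists i; rewrite mulVf //; apply: not_val_ge1_1.
Qed.

(* Pigeonhole: two powers of [b] are congruent, and [b] is a unit. *)
Lemma finite_residue_order (I : finType) (e : I -> F) b :
  b != 0 -> v b = 0 -> (forall k, exists i, val_ge v 1 (b ^+ k - e i)) ->
  exists k, val_ge v 1 (b ^+ k.+1 - 1).
Proof.
move=> b0 vb /choice[f fP]; pose h (k : 'I_#|I|.+1) := f k.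
have /injectivePn[k [l kl hkl]] : ~~ injectiveb h.
  by apply/negP => /injectiveP/leq_card; rewrite card_ord ltnn.
wlog lt_kl : k l kl hkl / (k < l)%N.
  move=> W; have : (k < l)%N \/ (l < k)%N by apply/orP; rewrite -neq_ltn.
  by case=> [/W|/W]; apply=> //; rewrite eq_sym.
exists (l - k).-1; rewrite prednK ?subn_gt0 //.
have: val_ge v 1 (b ^+ l - b ^+ k).
  apply: (subgroup_trans (val_ge_subgroup 1)) (fP l) _.
  by apply: (subgroup_sym (val_ge_subgroup 1)); rewrite -[f l]/(h l) -hkl; apply: fP.
have -> : b ^+ l - b ^+ k = b ^+ k * (b ^+ (l - k) - 1).
  by rewrite mulrBr mulr1 -exprD subnKC // ltnW.
have bk0 : b ^+ k != 0 by rewrite expf_neq0.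
move/(val_geMl (val_ge0V bk0 _)).
by rewrite mulKf //; apply; rewrite valX // vb mul0rn.
Qed.

End Valuation.
(** * Coverings and bases modulo a submodule *)

(** A covering bounds the index of [M] in [A] from above, and a packing of elements of [A] bounds it
    from below; a family that is both is a transversal of the quotient. *)
Definition covering (V : zmodType) (A M : set V) (I : Type) (e : I -> V) : Prop :=
  (forall i, A (e i)) /\ forall x, A x -> exists i, M (x - e i).

Definition packing (V : zmodType) (M : set V) (I : Type) (e : I -> V) : Prop :=
  forall i j, M (e i - e j) -> i = j.

Section Coverings.
Variables (V : zmodType) (A M : set V).
Hypothesis M_sub : subgroup M.

(** A covering of least size is a packing: of two congruent representatives, one could be
    dropped. *)
Lemma covering_transversal (I : finType) (e : I -> V) : covering A M e ->
  exists n (f : 'I_n -> V), covering A M f /\ packing M f.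
Proof.
pose Q n := `[< exists f : 'I_n -> V, covering A M f >].
move=> e_cov; have exQ : exists n, Q n.
  exists #|I|; apply/asboolP; exists (fun i => e (enum_val i)).
  split=> [i|x Ax]; first exact: e_cov.1.
  by have [i] := e_cov.2 x Ax; exists (enum_rank i); rewrite enum_rankK.
case: (ex_minnP exQ) => n Qn n_min.
have /asboolP[f f_cov] : `[< exists f : 'I_n -> V, covering A M f >] := Qn.
exists n, f; split=> // i j Mij.
apply: contrapT => /eqP neq_ij; case: n => [|n] in Qn f f_cov n_min i j Mij neq_ij *.
  by case: i neq_ij {Mij}.
suff /n_min : Q n by rewrite ltnn.
apply/asboolP; exists (fun k => f (lift i k)).
split=> [k|x Ax]; first exact: f_cov.1.
have [k Mk] := f_cov.2 x Ax; case: (unliftP i k) => [l kE|ki].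
  by exists l; rewrite -kE.
case: (unliftP i j) => [l jE|ji]; last by rewrite ji eqxx in neq_ij.
exists l; rewrite -jE; apply: (subgroup_trans M_sub) Mij.
by rewrite -ki.
Qed.

End Coverings.

Section ResidueModule.
Variables (F : fieldType) (v : F -> int) (V : vectType F) (A M : set V).
Hypotheses (v_val : is_valuation v) (M_sub : subgroup M).
Hypothesis M_scale : forall c x, val_ge v 0 c -> M x -> M (c *: x).

(** Independence over the residue field of the images of [e] modulo [M], phrased with integral lifts
    of the coefficients; [residue_spans] is phrased likewise. *)
Definition residue_free k (e : 'I_k -> V) : Prop :=
  forall c : 'I_k -> F, (forall i, val_ge v 0 (c i)) ->
    M (\sum_i c i *: e i) -> forall i, val_ge v 1 (c i).

Definition residue_spans k (e : 'I_k -> V) : Prop :=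
  forall x, A x -> exists c : 'I_k -> F,
    (forall i, val_ge v 0 (c i)) /\ M (x - \sum_i c i *: e i).

(** An [F]-linear relation, scaled to be primitive, would have integral coefficients not all in the
    maximal ideal. *)
Lemma residue_free_le_dim k (e : 'I_k -> V) :
  residue_free e -> (k <= \dim {: V})%N.
Proof.
move=> e_free; have: free [tuple e i | i < k].
  apply/freeP => c; have -> : \sum_(i < k) c i *: [tuple e i | i < k]`_i =
      \sum_i c i *: e i by apply: eq_bigr => i _; rewrite -tnth_nth tnth_mktuple.
  move=> c0; apply: contrapT => /existsNP[i /eqP ci].
  have [a a0 [ac_ge0 [l []]]] := primitive_scaling v_val (ex_intro _ i ci).
  apply: (e_free (fun i => a * c i)) => //; under eq_bigr do rewrite -scalerA.
  by rewrite -scaler_sumr c0 scaler0; apply: subgroup0.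
by rewrite /free size_tuple => /eqP <-; apply/dimvS/subvf.
Qed.

Hypothesis p_scale : forall c x, val_ge v 1 c -> A x -> M (c *: x).

(** A residue-free family in [A] of maximal size spans: if adjoining [x] breaks freeness, some
    relation gives [x] a unit coefficient, and dividing by it expresses [x] through [e]. *)
Lemma residue_basis : exists k (e : 'I_k -> V),
  (forall i, A (e i)) /\ residue_free e /\ residue_spans e.
Proof.
pose Q k := `[< exists2 e : 'I_k -> V, forall i, A (e i) & residue_free e >].
have exQ : exists k, Q k.
  exists 0%N; apply/asboolP; exists (fun=> 0) => [[]//|c _ _ []//].
have maxQ k : Q k -> (k <= \dim {: V})%N.
  by move=> /asboolP[e _ /residue_free_le_dim].
case: (ex_maxnP exQ maxQ) => k Qk k_max.
have /asboolP[e Ae e_free] :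
  `[< exists2 e : 'I_k -> V, forall i, A (e i) & residue_free e >] := Qk.
exists k, e; do 2!split=> //; move=> x Ax.
apply: contrapT => Nspan; suff /k_max : Q k.+1 by rewrite ltnn.
apply/asboolP; exists (fun i => if unlift ord0 i is Some l then e l else x).
  by move=> i; case: (unlift _ _).
move=> c c_ge0; rewrite big_ord_recl unlift_none.
under eq_bigr do rewrite liftK.
have [c0_ge1|/(not_val_ge1 (c_ge0 ord0))[c0 vc0]] := EM (val_ge v 1 (c ord0)).
  move=> Mc i; case: (unliftP ord0 i) => [l ->|-> //].
  apply: (e_free (fun l => c (lift ord0 l))) => //.
  by rewrite -[X in M X](addKr (c ord0 *: x)) addrC; apply: subgroupB => //; apply: p_scale.
move=> /(M_scale (val_ge0V v_val c0 vc0)).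
rewrite scalerDr scalerA mulVf // scale1r scaler_sumr => Mx; case: Nspan.
exists (fun l => - ((c ord0)^-1 * c (lift ord0 l))); split=> [l|].
  by apply: val_geN => //; apply: val_geMl => //; apply: val_ge0V.
by under eq_bigr do rewrite scaleNr -scalerA; rewrite sumrN opprK.
Qed.

(** Counts the points of a residue space: lifts of coordinate vectors give at least [#|I| ^ k]
    classes here, and at most that many in [residue_covering]. *)
Lemma residue_packing k (e : 'I_k -> V) (I : finType) (T : I -> F) :
  residue_free e -> (forall i, val_ge v 0 (T i)) -> packing (val_ge v 1) T ->
  packing M (fun h : {ffun 'I_k -> I} => \sum_i T (h i) *: e i).
Proof.
move=> e_free T_ge0 T_pack h h'; rewrite -sumrB.
under eq_bigr do rewrite -scalerBl.
move=> /e_free hh'; apply/ffunP => i; apply: T_pack; apply: hh' => l.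
by apply: (subgroupB (val_ge_subgroup v_val 0)).
Qed.

Hypotheses (A_sub : subgroup A).
Hypothesis A_scale : forall c x, val_ge v 0 c -> A x -> A (c *: x).

Lemma residue_covering k (e : 'I_k -> V) (I : finType) (T : I -> F) :
  (forall i, A (e i)) -> residue_spans e ->
  covering (val_ge v 0) (val_ge v 1) T ->
  covering A M (fun h : {ffun 'I_k -> I} => \sum_i T (h i) *: e i).
Proof.
move=> Ae e_span [T_ge0 T_cov]; split=> [h|x /e_span[c [c_ge0 Mx]]].
  by apply: subgroup_sum => // i _; apply: A_scale.
have /choice[h hP] : forall i, exists l, val_ge v 1 (c i - T l).
  by move=> i; apply: T_cov.
exists [ffun i => h i]; apply: (subgroup_trans M_sub Mx).
rewrite -sumrB; apply: subgroup_sum => // i _.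
by rewrite ffunE -scalerBl; apply: p_scale.
Qed.

End ResidueModule.
(** * Places of number fields *)

Lemma int_val_ge0 (F : fieldType) (v : F -> int) (z : int) :
  is_valuation v -> val_ge v 0 z%:~R.
Proof.
move=> v_val; have ge0n n : val_ge v 0 n%:R.
  elim: n => [|n IHn]; first exact: val_ge0.
  by rewrite -addn1 natrD; apply: v_val.2 => //; apply: val_ge_1.
by case: z => n; [exact: ge0n | apply: val_geN].
Qed.

(** Divided by [x ^+ d], the monic equation of degree [d.+1] writes [x] as a polynomial in [x^-1],
    which has nonnegative valuation if [v x < 0]. *)
Lemma integral_val_ge0 (R : nzRingType) (F : fieldType) (f : {rmorphism R -> F})
    (v : F -> int) x : is_valuation v -> (forall r, val_ge v 0 (f r)) ->
  integralOver f x -> val_ge v 0 x.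
Proof.
move=> v_val f_ge0 [p p_mon px0] x0; rewrite leNgt; apply/negP => vx_lt0.
have vxV : val_ge v 0 x^-1.
  by move=> _; rewrite valV // oppr_ge0 ltW.
pose q := map_poly f p; have q_mon : q \is monic by apply: monic_map.
have q_ge0 i : val_ge v 0 q`_i by rewrite coef_map; apply: f_ge0.
have: q.[x] = 0 by apply/rootP.
case Dd : (size q) => [|[|d]].
- by move/eqP: Dd; rewrite size_poly_eq0 (negPf (monic_neq0 q_mon)).
- have /size_poly1P[c c0 ->] : size q == 1%N by rewrite Dd.
  by rewrite hornerC => /eqP; rewrite (negPf c0).
have q_lead : q`_d.+1 = 1 by move/monicP: q_mon; rewrite lead_coefE Dd.
rewrite horner_coef Dd big_ord_recr /= q_lead mul1r => /eqP.
rewrite addrC addr_eq0 => /eqP xd.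
have : x = - \sum_(i < d.+1) q`_i * x^-1 ^+ (d - i).
  have xd0 : x ^+ d != 0 by rewrite expf_neq0.
  apply: (mulfI xd0); rewrite -exprSr xd mulrN mulr_sumr; congr (- _).
  apply: eq_bigr => i _; rewrite mulrCA; congr (_ * _).
  have lei : (i <= d)%N by rewrite -ltnS.
  by rewrite -{2}(subnKC lei) exprD -mulrA exprVn divff ?mulr1 // expf_neq0.
move=> xE; suff /(_ x0) : val_ge v 0 x by rewrite leNgt vx_lt0.
rewrite xE; apply: val_geN => //; apply: (subgroup_sum (val_ge_subgroup v_val 0)) => i _.
by apply: val_geMl => //; apply: val_geX.
Qed.

Section ResidueCharacteristic.
Variables (F : fieldType) (v : F -> int).
Hypothesis v_val : is_valuation v.
Hypothesis v_nat : exists N : nat, (0 < N)%N /\ val_ge v 1 N%:R.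

(* [N] is the least positive integer of positive valuation. *)
Lemma residue_char : exists2 N : nat, (1 < N)%N &
  forall z : int, val_ge v 1 z%:~R <-> (N %| z)%Z.
Proof.
have exQ : exists n, (0 < n)%N && `[< val_ge v 1 n%:R >].
  by case: v_nat => N [N0 vN]; exists N; rewrite N0; apply/asboolP.
case: (ex_minnP exQ) => N /andP[N0 /asboolP vN] N_min; exists N.
  case: N N0 vN N_min => [|[|]] // _ v1 _; by case: (not_val_ge1_1 v_val).
have vNz (z : int) : val_ge v 1 (z * N%:Z)%:~R.
  by rewrite intrM; apply: val_geMl => //; apply: int_val_ge0.
move=> z; split=> [vz|/dvdzP[q ->]]; last exact: vNz.
have Nz : N%:Z != 0 by case: (N) N0.
have: val_ge v 1 (z %% N)%Z%:~R.
  have -> : (z %% N)%Z = z - (z %/ N)%Z * N%:Z by rewrite {2}(divz_eq z N) addrC addKr.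
  by rewrite intrB; apply: (subgroupB (val_ge_subgroup v_val 1)).
move: (ltz_mod z Nz) (modz_ge0 z Nz) => lt_zN ge0_z vn; apply/dvdz_mod0P.
case: (z %% N)%Z lt_zN ge0_z vn => [[|n]|n] // lt_nN _ vn.
have : (N <= n.+1)%N by apply: N_min; rewrite ltn0Sn; apply/asboolP.
by rewrite leqNgt (_ : (n.+1 < N)%N).
Qed.

End ResidueCharacteristic.
(** The natural numbers below the residue characteristic [N] represent all residues: a denominator
    that is a unit at [u] has a power congruent to 1, so its inverse is congruent to an integer. *)
Lemma rat_residue_covering (u : rat -> int) : is_valuation u ->
  (exists N : nat, (0 < N)%N /\ val_ge u 1 N%:R) ->
  exists n (e : 'I_n -> rat), covering (val_ge u 0) (val_ge u 1) e.
Proof.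
move=> u_val u_nat; have [N N1 NP] := residue_char u_val u_nat.
exists N, (fun i => i%:R); split=> [i|x x_ge0].
  by rewrite pmulrn; apply: int_val_ge0.
have Nz : N%:Z != 0 by case: (N) N1.
have int_cov (z : int) : exists i : 'I_N, val_ge u 1 (z%:~R - i%:R).
  have ltzN : (`|(z %% N)%Z| < N)%N.
    rewrite -ltz_nat gez0_abs ?modz_ge0 //.
    by have := ltz_mod z Nz.
  exists (Ordinal ltzN) => /=.
  rewrite pmulrn gez0_abs ?modz_ge0 //.
  rewrite -intrB; apply/NP; rewrite {1}(divz_eq z N) addrK.
  exact: dvdz_mull.
have b0 : (denq x)%:~R != 0 :> rat by rewrite intr_eq0 denq_eq0.
have xE : x * (denq x)%:~R = (numq x)%:~R by rewrite numqE.
(* A denominator in the maximal ideal would force the numerator there too, against lowest terms. *)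
have [_ ub] : (denq x)%:~R != 0 :> rat /\ u (denq x)%:~R = 0.
  apply: not_val_ge1 => // [|ub]; first exact: int_val_ge0.
  have Nb : (N %| denq x)%Z by apply/NP.
  have Na : (N %| numq x)%Z.
    by apply/NP; rewrite -xE; apply: (val_geMl u_val).
  have : (N %| gcdn `|numq x| `|denq x|)%N by rewrite dvdn_gcd; apply/andP.
  by rewrite (eqP (coprime_num_den x)) dvdn1 => /eqP NE; rewrite NE in N1.
have [k bk] : exists k, val_ge u 1 ((denq x)%:~R ^+ k.+1 - 1).
  apply: (finite_residue_order u_val (I := 'I_N) (e := fun i => i%:R)) => // k.
  by rewrite -rmorphXn; apply: int_cov.
have [i iP] := int_cov (numq x * denq x ^+ k); exists i.
apply: (subgroup_trans (val_ge_subgroup u_val 1)) iP.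
rewrite intrM rmorphXn /= -xE -mulrA -exprS -{1}[x]mulr1 -mulrBr.
apply: val_geMl => //.
exact: (subgroup_sym (val_ge_subgroup u_val 1)).
Qed.

Lemma fieldExt_integral (F : fieldType) (E : fieldExtType F) (x : E) :
  integralOver (in_alg E) x.
Proof.
have /polyOver1P[p pE] := minPolyOver 1 x.
exists p; last by rewrite -pE root_minPoly.
by rewrite -(map_monic (in_alg E)) -pE monic_minPoly.
Qed.

Section NumberField.
Variables (F : fieldType) (f : {rmorphism rat -> F}) (v : F -> int).
Hypothesis F_alg : forall x, integralOver f x.
Hypothesis v_val : discrete_valuation v.

Let v_isval : is_valuation v := discrete_is_valuation v_val.

(** Otherwise [v] would be trivial on [rat], and every element, being algebraic over [rat], would
    have nonnegative valuation, even the inverse of an element of valuation 1. *)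
Lemma place_nat_pos : exists N : nat, (0 < N)%N /\ val_ge v 1 N%:R.
Proof.
apply: contrapT => /forallNP noN.
have v_int (z : int) : z != 0 -> v z%:~R = 0.
  have v_nat (n : nat) : (0 < n)%N -> v n%:R = 0.
    move=> n0; apply: (not_val_ge1 _ _).2 => //; first by rewrite pmulrn; apply: int_val_ge0.
    by move=> vn; apply: (noN n).
  case: z => [[|n]|n] // _; first exact: v_nat.
  rewrite NegzE rmorphN /= -[LHS](_ : v (- 1 * n.+1%:R) = _); last by rewrite mulN1r.
  have n0 : n.+1%:R != 0 :> F.
    by rewrite -(rmorph_nat f) fmorph_eq0 pnatr_eq0.
  rewrite v_isval.1 ?oppr_eq0 ?oner_eq0 // v_nat // addr0.
  have : v ((- 1) ^+ 2) = 0 by rewrite sqrrN expr1n val1.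
  by rewrite valX ?oppr_eq0 ?oner_eq0 // => /eqP; rewrite mulrn_eq0 /= => /eqP.
have f_int (z : int) : z != 0 -> z%:~R != 0 :> F.
  by move=> z0; rewrite -(rmorph_int f) fmorph_eq0 intr_eq0.
have f_ge0 r : val_ge v 0 (f r).
  move=> fr0; have r0 : r != 0 by apply: contraNneq fr0 => ->; rewrite rmorph0.
  have numq0 : numq r != 0 by rewrite numq_eq0.
  rewrite -(divq_num_den r) fmorph_div !rmorph_int.
  rewrite v_isval.1 ?invr_eq0 ?f_int ?denq_eq0 //.
  by rewrite valV ?f_int ?denq_eq0 // !v_int ?denq_eq0.
have [x x0 vx] := val_surj v_val.
have := integral_val_ge0 v_isval f_ge0 (F_alg x^-1).
by rewrite /val_ge invr_eq0 => /(_ x0); rewrite valV // vx.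
Qed.

(* Dedekind: in a relation [p.[y] = 0], the product of [y] with the leading
   coefficient [c] is integral, so [c y] can be absorbed in the next
   coefficient as long as [c] is not a unit at [v]. *)
Lemma root_fraction y (p : {poly F}) : val_ge v 0 y ->
  (forall i, integralOver (intr : int -> F) p`_i) -> p.[y] = 0 ->
  (exists i, ~ val_ge v 1 p`_i) ->
  exists a b, [/\ integralOver (intr : int -> F) a,
    integralOver (intr : int -> F) b, ~ val_ge v 1 b & b * y = a].
Proof.
move=> y_ge0; have int_ge0 x : integralOver (intr : int -> F) x -> val_ge v 0 x.
  by apply: integral_val_ge0 => // z; apply: int_val_ge0.
have [n] := ubnP (size p); elim: n p => // n IHn p /ltnSE le_pn p_int py0 [i0 vi0].
case Dd : (size p) => [|[|d]].
- move/eqP: Dd vi0; rewrite size_poly_eq0 => /eqP ->; rewrite coef0 => [[]].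
  exact: val_ge0.
- have /size_poly1P[c c0 pE] : size p == 1%N by rewrite Dd.
  by move: py0; rewrite pE hornerC => /eqP; rewrite (negPf c0).
pose c := p`_d.+1; have cy_int : integralOver (intr : int -> F) (c * y).
  (* Multiplying [p.[y]] by [c ^+ d] gives a monic equation for [c * y]. *)
  pose q : {poly F} := 'X^(d.+1) + \poly_(i < d.+1) (p`_i * c ^+ (d - i)).
  have q_mon : q \is monic.
    rewrite monicE lead_coefDl ?lead_coefXn // size_polyXn.
    by apply: (leq_ltn_trans (size_poly _ _)).
  apply: (@integral_root_monic _ _ (intr : {rmorphism int -> F}) _ q) => //.
    rewrite rootE hornerD hornerXn horner_poly.
    have -> : (c * y) ^+ d.+1 + \sum_(i < d.+1) p`_i * c ^+ (d - i) * (c * y) ^+ i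
       = c ^+ d * p.[y].
      rewrite horner_coef Dd [in RHS]big_ord_recr /= mulrDr mulr_sumr addrC; congr (_ + _).
        apply: eq_bigr => i _; have le_id : (i <= d)%N by rewrite -ltnS.
        have -> : c ^+ d = c ^+ (d - i) * c ^+ i by rewrite -exprD subnK.
        by rewrite exprMn -!mulrA mulrCA; congr (_ * _); rewrite mulrCA.
      by rewrite exprMn exprSr -mulrA.
    by rewrite py0 mulr0.
  apply/integral_poly => i; rewrite coefD coefXn coef_poly.
  apply: integral_add; first exact: integral_nat.
  case: ifP => _; last exact: integral0.
  apply: integral_mul => //; elim: (d - i)%N => [|k IHk]; first exact: integral1.
  by rewrite exprS; apply: integral_mul; [exact: p_int | exact: IHk].
have [c_ge1|] := EM (val_ge v 1 c); last first.
  by move=> vc; exists (c * y), c; split => //; apply: p_int.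
apply: (IHn (\poly_(i < d.+1) (p`_i + (c * y) *+ (i == d)))).
- by apply: leq_ltn_trans (size_poly _ _) _; rewrite -Dd.
- move=> i; rewrite coef_poly; case: ifP => _; last exact: integral0.
  apply: integral_add => //; case: eqP => _ //; exact: integral0.
- rewrite horner_poly -[RHS]py0 horner_coef Dd !big_ord_recr /= eqxx.
  under eq_bigr => i _ do rewrite (ltn_eqF (ltn_ord i)) addr0.
  by rewrite -addrA; congr (_ + _); rewrite mulrDl exprS mulrA.
(* A coefficient outside the maximal ideal survives: [i0] is not the top index because [c] is in the
   ideal, and adding [c * y], also in the ideal, cannot move coefficient [d] into it. *)
- exists i0; rewrite coef_poly; case: ltnP => [lt_i0|].
    case: eqP => _; last by rewrite addr0.
    rewrite mulr1n => v1; apply: vi0; rewrite -[p`_i0](addrK (c * y)).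
    by apply: (subgroupB (val_ge_subgroup v_isval 1)) => //; apply: val_geMr.
  rewrite leq_eqVlt => /orP[/eqP i0E|]; first by case: vi0; rewrite -i0E.
  by rewrite -Dd => /(nth_default 0) p0; case: vi0; rewrite p0; apply: val_ge0.
Qed.

(** [root_fraction] applies to a primitive integer polynomial vanishing at [y]: if all its
    coefficients had positive valuation, the residue characteristic would divide its content. *)
Lemma integral_fraction y : val_ge v 0 y ->
  exists a b, [/\ integralOver (intr : int -> F) a,
    integralOver (intr : int -> F) b, ~ val_ge v 1 b & b * y = a].
Proof.
move=> y_ge0; have [p p_mon py0] := F_alg y.
have [q [a a0 pE]] := rat_poly_scale p.
have q0 : q != 0.
  by apply: contraTneq (monic_neq0 p_mon) => q0; rewrite pE q0 map_poly0 scaler0 eqxx.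
pose r := map_poly (intr : int -> F) (zprimitive q).
apply: (@root_fraction y r) => //.
- by move=> i; rewrite coef_map; apply: integral_id.
- have fq : map_poly (intr : int -> F) q = map_poly f (map_poly intr q).
    rewrite -map_poly_comp; apply: eq_map_poly => z /=; by rewrite rmorph_int.
  have qy0 : (map_poly (intr : int -> F) q).[y] = 0.
    move/rootP: py0; rewrite pE linearZ /= hornerZ => /eqP.
    rewrite mulf_eq0 fmorph_eq0 invr_eq0 intr_eq0 (negPf a0) /= => /eqP.
    by rewrite fq.
  move: qy0; rewrite {1}(zpolyEprim q) linearZ /= hornerZ => /eqP.
  rewrite mulf_eq0 => /orP[|/eqP //].
  by rewrite -(rmorph_int f) fmorph_eq0 intr_eq0 zcontents_eq0 (negPf q0).
- have [N N1 NP] := residue_char v_isval place_nat_pos.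
  apply: contrapT => /forallNP vr; move: N1.
  have : (N %| zcontents (zprimitive q))%Z.
    rewrite dvdz_contents; apply/polyOverP => i.
    by apply/NP; have /contrapT := vr i; rewrite coef_map.
  by rewrite zcontents_primitive q0 dvdz1 /=; lia.
Qed.

(** The integers map onto the residue field: write [y] as [a / b] with [b] a unit at [v]; as the
    residue field is finite, some power of [b] is an inverse of [b] modulo the maximal ideal. *)
Lemma integral_approx n (e : 'I_n -> F) y :
  covering (val_ge v 0) (val_ge v 1) e -> val_ge v 0 y ->
  exists2 a, integralOver (intr : int -> F) a & val_ge v 1 (y - a).
Proof.
move=> [_ e_cov] y_ge0; have [a [b [a_int b_int vb ab]]] := integral_fraction y_ge0.
have b_ge0 : val_ge v 0 b.
  by apply: (integral_val_ge0 _ _ b_int) => // z; apply: int_val_ge0.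
have [b0 vb0] := not_val_ge1 b_ge0 vb.
have [k bk] : exists k, val_ge v 1 (b ^+ k.+1 - 1).
  by apply: (finite_residue_order v_isval) => // k; apply/e_cov/val_geX.
exists (a * b ^+ k).
  apply: integral_mul => //; elim: k {bk} => [|k IHk]; first exact: integral1.
  by rewrite exprS; apply: integral_mul.
rewrite -ab mulrAC -exprS mulrC -{1}[y]mulr1 -mulrBr; apply: val_geMl => //.
exact: (subgroup_sym (val_ge_subgroup v_isval 1)).
Qed.

End NumberField.

(** * Valuations extending one of the base field with index one *)

Section UnramifiedExtension.
Variables (F : fieldType) (E : fieldExtType F) (u : F -> int) (w : E -> int).
Hypotheses (u_val : is_valuation u) (w_val : is_valuation w).
Hypothesis w_ext : forall c, c != 0 -> w c%:A = u c.

Lemma val_ge_in_alg N c : val_ge w N c%:A <-> val_ge u N c.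
Proof.
rewrite /val_ge -[c%:A]/(in_alg E c) fmorph_eq0.
by split=> vc c0; move: (vc c0); rewrite /= w_ext.
Qed.

Lemma val_geZ M N c x : val_ge u M c -> val_ge w N x -> val_ge w (M + N) (c *: x).
Proof. by rewrite -mulr_algl -val_ge_in_alg; apply: (val_geM w_val). Qed.

Lemma val_geZl N c x : val_ge u 0 c -> val_ge w N x -> val_ge w N (c *: x).
Proof. by rewrite -{2}[N]add0r; apply: val_geZ. Qed.

Lemma val_geZr N c x : val_ge u N c -> val_ge w 0 x -> val_ge w N (c *: x).
Proof. by rewrite -{2}[N]addr0; apply: val_geZ. Qed.

Lemma residue_basis_ext : exists k (e : 'I_k -> E),
  [/\ forall i, val_ge w 0 (e i), residue_free u (val_ge w 1) e
    & residue_spans u (val_ge w 0) (val_ge w 1) e].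
Proof.
have M_sub := val_ge_subgroup w_val 1.
have [] := @residue_basis _ u E (val_ge w 0) (val_ge w 1) u_val M_sub.
- by move=> c x; apply: val_geZl.
- by move=> c x; apply: val_geZr.
by move=> k [e [e_ge0 [e_free e_span]]]; exists k, e.
Qed.

Lemma residue_covering_ext n (T : 'I_n -> F) :
  covering (val_ge u 0) (val_ge u 1) T ->
  exists m (e : 'I_m -> E), covering (val_ge w 0) (val_ge w 1) e.
Proof.
move=> T_cov; have A_sub := val_ge_subgroup w_val 0.
have M_sub := val_ge_subgroup w_val 1.
have [k [e [e_ge0 _ e_span]]] := residue_basis_ext.
have e'_cov : covering (val_ge w 0) (val_ge w 1)
    (fun h : {ffun 'I_k -> 'I_n} => \sum_i T (h i) *: e i).
  by apply: (@residue_covering _ u) => // c x; [apply: val_geZr | apply: val_geZl].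
have [m [t [t_cov _]]] := covering_transversal M_sub e'_cov.
by exists m, t.
Qed.

End UnramifiedExtension.

(** Finiteness goes up from the restriction [u] of [v] to [rat]. As [u] need not be normalized, [v]
    extends it with index one whatever the ramification. *)
Lemma number_field_residue_covering (K : fieldExtType rat) (v : K -> int) :
  discrete_valuation v ->
  exists n (e : 'I_n -> K), covering (val_ge v 0) (val_ge v 1) e.
Proof.
move=> v_val; have v_isval := discrete_is_valuation v_val.
have [N [N0 vN]] := place_nat_pos (@fieldExt_integral _ K) v_val.
pose u (r : rat) := v r%:A.
have uE M r : val_ge v M r%:A <-> val_ge u M r by apply: val_ge_in_alg.
have u_val : is_valuation u.
  split=> [x y x0 y0|M x y].
    rewrite /u -[_%:A]/(in_alg K _) rmorphM /= v_isval.1 //.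
      by rewrite -[_%:A]/(in_alg K _) fmorph_eq0.
    by rewrite -[_%:A]/(in_alg K _) fmorph_eq0.
  by rewrite -!uE scalerDl; apply: v_isval.2.
have [|n [T T_cov]] := rat_residue_covering u_val.
  exists N; split=> //; apply/uE.
  by rewrite -[_%:A]/(in_alg K _) rmorph_nat.
exact: residue_covering_ext T_cov.
Qed.
(** * Unramified extensions of a complete field *)

Section CompleteBase.
Variables (F : fieldType) (E : fieldExtType F) (u : F -> int) (w : E -> int).
Hypotheses (u_disc : discrete_valuation u) (w_val : is_valuation w).
Hypothesis w_ext : forall c, c != 0 -> w c%:A = u c.
Hypothesis u_complete : forall s : nat -> F,
  (forall N : int, exists n0 : nat, forall p q : nat,
     (n0 <= p)%N -> (n0 <= q)%N -> val_ge u N (s p - s q)) ->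
  exists l : F, forall N : int, exists n0 : nat, forall p : nat,
    (n0 <= p)%N -> val_ge u N (s p - l).

Let u_val : is_valuation u := discrete_is_valuation u_disc.

Lemma val_ge_nat_eq0 x : (forall n : nat, val_ge w n x) -> x = 0.
Proof.
move=> vx; apply: contrapT => /eqP x0.
by have := vx `|w x|.+1 x0; rewrite leNgt intS; case/negP; lia.
Qed.

(** The terms from [n] on have valuation at least [n], so the partial sums are Cauchy and the limit
    inherits the estimate. *)
Lemma series_converges t (c : nat -> F) : u t = 1 -> t != 0 ->
  (forall n, val_ge u 0 (c n)) ->
  exists l, forall n : nat, val_ge u n (\sum_(k < n) t ^+ k * c k - l).
Proof.
move=> ut t0 c_ge0; pose s n := \sum_(k < n) t ^+ k * c k.
have U n := val_ge_subgroup u_val n.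
have tX (k : nat) : val_ge u k (t ^+ k) by move=> _; rewrite valX // ut natz.
have s_ge (n p : nat) : (n <= p)%N -> val_ge u n (s p - s n).
  elim: p => [|p IHp]; first by rewrite leqn0 => /eqP ->; rewrite subrr; apply: val_ge0.
  rewrite leq_eqVlt => /orP[/eqP ->|le_np]; first by rewrite subrr; apply: val_ge0.
  rewrite {1}/s big_ord_recr /= -/(s p) addrAC; apply: (subgroupD (U n)); first exact: IHp.
  by apply: val_geMr => //; apply: (val_geW _ (tX p)); rewrite lez_nat.
have [l lP] : exists l : F, forall N : int, exists n0 : nat, forall p : nat,
    (n0 <= p)%N -> val_ge u N (s p - l).
  apply: u_complete => N; exists `|N|%N => p q le_p le_q.
  apply: (val_geW (_ : N <= `|N|%N)); first by lia.
  rewrite -(subrKA (s `|N|%N)) -[s `|N|%N - s q]opprB.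
  by apply: (subgroupB (U _)); apply: s_ge.
exists l => n; have [n0 n0P] := lP n.
apply: (subgroup_trans (U n)) (n0P (maxn n0 n) (leq_maxl _ _)).
by apply: (subgroup_sym (U n)); apply/s_ge/leq_maxr.
Qed.

(* Successive approximation: [x - \sum_i c i *: e i = t *: next x] with [next x]
   again integral, so the coordinates of [x] are convergent power series in [t]. *)
Lemma residue_spans_dim k (e : 'I_k -> E) : (forall i, val_ge w 0 (e i)) ->
  residue_spans u (val_ge w 0) (val_ge w 1) e -> (\dim {: E} <= k)%N.
Proof.
move=> e_ge0 e_span; have [t t0 ut] := val_surj u_disc.
have : forall x, exists c : 'I_k -> F, val_ge w 0 x ->
    (forall i, val_ge u 0 (c i)) /\ val_ge w 1 (x - \sum_i c i *: e i).
  move=> x; have [/e_span[c cP]|Nx] := EM (val_ge w 0 x); first by exists c.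
  by exists (fun=> 0).
move=> /choice[c cP].
pose next x := t^-1 *: (x - \sum_i c x i *: e i).
have nextE x : t *: next x = x - \sum_i c x i *: e i.
  by rewrite /next scalerA mulfV // scale1r.
have next_ge0 x : val_ge w 0 x -> val_ge w 0 (next x).
  move=> /cP[_ Mx]; rewrite -[0](addNr 1) ; apply: (val_geZ w_val w_ext) => //.
  by move=> _; rewrite valV // ut.
have iter_ge0 x n : val_ge w 0 x -> val_ge w 0 (iter n next x).
  by move=> x_ge0; elim: n => //= n; apply: next_ge0.
have iterE x n : x = \sum_i (\sum_(l < n) t ^+ l * c (iter l next x) i) *: e i
    + t ^+ n *: iter n next x.
  elim: n => [|n IHn].
    by rewrite expr0 scale1r big1 ?add0r // => i _; rewrite big_ord0 scale0r.
  rewrite {1}IHn; under [in RHS]eq_bigr do rewrite big_ord_recr /= scalerDl -scalerA.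
  rewrite big_split /= -addrA; congr (_ + _); rewrite -scaler_sumr.
  by rewrite exprSr -scalerA nextE -scalerDr addrC subrK.
have span_ge0 x : val_ge w 0 x -> x \in <<[tuple e i | i < k]>>%VS.
  move=> x_ge0.
  have /choice[l lP] : forall i, exists l, forall n : nat,
      val_ge u n (\sum_(m < n) t ^+ m * c (iter m next x) i - l).
    move=> i; apply: (series_converges (c := fun m => c (iter m next x) i)) => // n.
    exact: (cP _ (iter_ge0 _ _ x_ge0)).1.
  have -> : x = \sum_i l i *: e i.
    apply/eqP; rewrite -subr_eq0; apply/eqP/val_ge_nat_eq0 => n.
    rewrite {1}(iterE x n) addrAC -sumrB; apply: w_val.2.
      apply: (subgroup_sum (val_ge_subgroup w_val n)) => i _; rewrite -scalerBl.
      by apply: (val_geZr w_val w_ext).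
    apply: (val_geZr w_val w_ext); last by apply: iter_ge0.
    by move=> _; rewrite (valX u_val) // ut natz.
  apply: memv_suml => i _; apply/memvZ/memv_span.
  by apply/mapP; exists i; rewrite ?mem_enum.
(* Every [x] is a power of [t^-1] times an integral element. *)
have : (fullv <= <<[tuple e i | i < k]>>)%VS.
  apply/subvP => x _; have [->|x0] := eqVneq x 0; first exact: mem0v.
  pose N := `|w x|%N; rewrite -[x](@scalerK _ _ (t ^+ N)) ?unitfE ?expf_neq0 //.
  apply/memvZ/span_ge0; rewrite -[0](subrr N%:Z).
  apply: (val_geZ w_val w_ext); last by move=> _; rewrite /N; lia.
  by move=> _; rewrite valX // ut natz.
move=> /dimvS/leq_trans; apply.
by apply: leq_trans (dim_span _) _; rewrite size_tuple.
Qed.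

End CompleteBase.
(** * Degrees in a central division algebra *)

Section DivisionAlgebra.
Variables (F : fieldType) (D : falgType F).
Hypotheses (D_div : division D) (D_central : central D).

Lemma central_scalar (x : D) : (forall z, z * x = x * z) -> exists c, x = c%:A.
Proof.
move=> x_comm; have : x \in 'Z({: D})%VS.
  by rewrite memv_cap memvf; apply/centvP => z _; rewrite x_comm.
by rewrite D_central => /vlineP[c ->]; exists c.
Qed.

(* Artin-Whaples: after scaling [d 0] to [1], commuting the relation with [z]
   shortens it, so the other coefficients are central. *)
Lemma free_bimodule (X : seq D) (d : nat -> D) : free X ->
  (forall y, \sum_(i < size X) X`_i * y * d i = 0) ->
  forall i, (i < size X)%N -> d i = 0.
Proof.
elim: X d => // x X IHX d; rewrite free_cons => /andP[xNX X_free] dX.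
have d0 : d 0%N = 0.
  apply: contrapT => /eqP/D_div d0U; case/negP: xNX.
  have [b xb] : exists b : nat -> D,
      forall y, x * y + \sum_(i < size X) X`_i * y * b i = 0.
    exists (fun i => d i.+1 / d 0%N) => y.
    have := congr1 (fun z => z / d 0%N) (dX y).
    rewrite mul0r big_ord_recl mulrDl mulr_suml /= mulrK // => xyE; apply: etrans xyE.
    by congr (_ + _); apply: eq_bigr => i _; rewrite mulrA.
  have b_comm i z : (i < size X)%N -> z * b i = b i * z.
    move=> lti; apply/eqP; rewrite -subr_eq0; apply/eqP.
    apply: (IHX (fun i => z * b i - b i * z)) lti => // y.
    under eq_bigr do rewrite mulrBr !mulrA.
    rewrite sumrB -mulr_suml.
    have := xb (y * z); under eq_bigr do rewrite mulrA.
    move/eqP; rewrite addr_eq0 => /eqP xyz; have /eqP := xb y.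
    rewrite addr_eq0 => /eqP xy; apply/eqP; rewrite subr_eq0 -eqr_opp. rewrite -xyz.
    by rewrite mulrA xy mulNr.
  have b_scal (i : 'I_(size X)) : exists c, b i = c%:A.
    by apply: central_scalar => z; apply: b_comm.
  (* At [y = 1] the relation puts [x] in the span of [X], against freeness. *)
  have -> : x = - \sum_(i < size X) X`_i * b i.
    have /eqP := xb 1; rewrite mulr1 addr_eq0 => /eqP ->.
    by congr (- _); apply: eq_bigr => i _; rewrite mulr1.
  rewrite memvN; apply: memv_suml => i _; have [c ->] := b_scal i.
  by rewrite mulr_algr; apply/memvZ/memv_span/mem_nth.
case=> // i; rewrite ltnS; apply: (IHX (fun i => d i.+1)) => // y.
by have := dX y; rewrite big_ord_recl /= d0 mulr0 add0r.
Qed.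

(* Let [X] be a basis of [D] over [A]. An [A]-linear map [y |-> \sum_i a_i y d_i],
   with [a] a basis of [A], is determined by its values on [X]; so
   [D ^ \dim A] embeds into [D ^ size X]. *)
Lemma commutative_subalgebra_dim (A : {aspace D}) m :
  \dim {: D} = (m ^ 2)%N -> (A <= 'C(A))%VS -> (\dim A <= m)%N.
Proof.
move=> D_dim /centvsP A_comm.
have [X [X_span X_dir X0]] :=
  skew_field_module_semisimple D_div (subvf (A * {: D})%VS).
have dimX : (\dim {: D} = size X * \dim A)%N.
  rewrite -X_span (directvP X_dir) /= big_seq.
  under eq_bigr => x xX.
    rewrite dim_cosetv_unit; last by apply/D_div; apply: contraNneq X0 => <-.
  over.
  by rewrite -big_seq big_const_seq count_predT iter_addn_0 mulnC.
(* The product of [\dim A] and [size X] is [m ^ 2], so this bounds [\dim A] by [m]. *)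
suff le_dX : (\dim A <= size X)%N.
  by rewrite -leq_sqr -D_dim dimX mulnC -[(\dim A ^ 2)%N]mulnn leq_mul2l le_dX orbT.
pose d := \dim A.
pose f (h : {ffun 'I_d -> D}) : {ffun 'I_(size X) -> D} :=
  [ffun j : 'I_(size X) => \sum_(i < d) (vbasis A)`_i * X`_j * h i].
have f_lin : linear f.
  move=> c h h'; apply/ffunP => j; rewrite !ffunE scaler_sumr -big_split /=.
  by apply: eq_bigr => i _; rewrite !ffunE mulrDr scalerAr.
pose fL : {linear _ -> _} := HB.pack f (GRing.isLinear.Build _ _ _ _ f f_lin).
have f_inj : injective (linfun fL).
  apply/lker0P; rewrite -subv0; apply/subvP => h; rewrite memv_ker lfunE memv0 /=.
  move=> /eqP/ffunP fh0; apply/eqP/ffunP => i; rewrite ffunE.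
  have szB : size (vbasis A) = d by rewrite size_tuple.
  pose h' k := if insub k is Some i then h i else 0.
  have h'E (k : 'I_d) : h' k = h k by rewrite /h' valK.
  rewrite -h'E; apply: (@free_bimodule (vbasis A) h'); rewrite ?szB //.
    exact: basis_free (vbasisP A).
  move=> y; under eq_bigr do rewrite h'E.
  have : y \in (\sum_(x <- X) A * <[x]>)%VS by rewrite X_span memvf.
  rewrite big_tnth => /memv_sumP[z zP ->].
  under eq_bigr do rewrite mulr_sumr mulr_suml.
  rewrite exchange_big big1 //= => j _.
  have /memv_cosetP[a aA ->] := zP j isT.
  have := congr1 ( *%R a) (fh0 j); rewrite !ffunE mulr0 mulr_sumr => fj.
  apply: etrans fj; apply: eq_bigr => k _.
  rewrite !mulrA (tnth_nth 0) (A_comm _ a) //.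
  by apply/vbasis_mem/mem_nth; rewrite szB.
have := limg_ker_dim (linfun fL) fullv.
move/lker0P/eqP: f_inj => ->; rewrite capv0 dimv0 add0n => dim_img.
have := dimvS (subvf (linfun fL @: fullv)); rewrite dim_img !dimvf /dim /= !card_ord.
have D0 : (0 < \dim {: D})%N := adim_gt0 {: D}%AS.
by rewrite leq_pmul2r // -dimvf.
Qed.

(** The subalgebra generated by [x] is commutative, hence of dimension at most [m]. *)
Lemma powers_dependent m (x : D) : \dim {: D} = (m ^ 2)%N ->
  exists c : 'I_m.+1 -> F, (exists i, c i != 0) /\ \sum_i c i *: x ^+ i = 0.
Proof.
move=> D_dim; pose A := agenv_aspace <[x]>%VS.
have xA : x \in A by rewrite (subvP (sub_agenv _)) ?memv_line.
(* A subalgebra containing [x] contains [A]. This is applied to the centralizer of [x], and then to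
   that of [A], which contains [x] by the first application. *)
have A_comm : (A <= 'C(A))%VS.
  have sub_cent (C : {aspace D}) : (1 <= C)%VS -> x \in C -> (A <= C)%VS.
    move=> C1 xC; apply: agenv_sub_modl => //.
    by rewrite -[X in (_ <= X)%VS](prodv_id C) prodvSl // -memvE.
  have : (A <= 'C[x])%VS by apply: sub_cent; rewrite ?cent1v_id // -memvE cent1v1.
  by rewrite subv_cent1 => xC; apply: sub_cent => //; rewrite -memvE centv1.
apply: contrapT => /forallNP Ndep.
have: free [tuple x ^+ i | i < m.+1].
  apply/freeP => c; have -> : \sum_(i < m.+1) c i *: [tuple x ^+ i | i < m.+1]`_i =
      \sum_(i < m.+1) c i *: x ^+ i.
    by apply: eq_bigr => i _; rewrite -tnth_nth tnth_mktuple.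
  move=> c0 i; apply: contrapT => /eqP ci; apply: (Ndep c); split=> //.
  by exists i.
rewrite /free size_tuple => /eqP dimX.
have : (<<[tuple (x ^+ i)%R | i < m.+1]>> <= A)%VS.
  apply/span_subvP => _ /mapP[i _ ->].
  elim: (nat_of_ord i) => [|k IHk]; first by rewrite expr0 memvE sub1_agenv.
  by rewrite exprS memvM.
move=> /dimvS; rewrite dimX => /leq_trans/(_ (commutative_subalgebra_dim D_dim A_comm)).
by rewrite ltnn.
Qed.

End DivisionAlgebra.
(** * The residue ring of an order *)

Section ResidueRing.
Variables (A : nzRingType) (O M : set A) (n : nat) (e : 'I_n -> A).
Hypotheses (O_sub : subgroup O) (O1 : O 1).
Hypothesis OM : forall x y, O x -> O y -> O (x * y).
Hypotheses (M_sub : subgroup M) (M1 : ~ M 1).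
Hypothesis M_mull : forall x y, O x -> M y -> M (x * y).
Hypothesis M_mulr : forall x y, M x -> O y -> M (x * y).
Hypothesis O_unit : forall x, O x -> ~ M x -> exists y, [/\ O y, x * y = 1 & y * x = 1].
Hypotheses (e_cov : covering O M e) (e_pack : packing M e).

(** The implication lets [cls] be total: elements outside [O] get an arbitrary index, and 1 only
    shows that there is one. *)
Fact residue_class_ex x : exists i, O x -> M (x - e i).
Proof.
have [/e_cov.2[i Mi]|Nx] := EM (O x); first by exists i.
by have [i _] := e_cov.2 1 O1; exists i.
Qed.

Let cls x : 'I_n := projT1 (cid (residue_class_ex x)).

Let clsP x : O x -> M (x - e (cls x)).
Proof. exact: (projT2 (cid (residue_class_ex x))). Qed.

Let O_e i : O (e i). Proof. exact: e_cov.1. Qed.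

Let M_sym x y : M (x - y) -> M (y - x). Proof. exact: subgroup_sym. Qed.

Let cls_eq x y : O x -> O y -> M (x - y) -> cls x = cls y.
Proof.
move=> Ox Oy Mxy; apply: e_pack.
apply: (subgroup_trans M_sub (M_sym (clsP Ox))).
exact: (subgroup_trans M_sub Mxy (clsP Oy)).
Qed.

Let clsK i : cls (e i) = i.
Proof. by apply: e_pack; apply/M_sym/clsP. Qed.

Let O_D x y : O x -> O y -> O (x + y). Proof. exact: subgroupD. Qed.

Let M_D x x' y y' : M (x - x') -> M (y - y') -> M ((x + y) - (x' + y')).
Proof. by move=> Mx My; rewrite opprD addrACA; apply: subgroupD. Qed.

Let M_M x x' y y' : O x -> O y' -> M (x - x') -> M (y - y') -> M (x * y - x' * y').
Proof.
move=> Ox Oy' Mx My; apply: (subgroup_trans M_sub (y := x * y')).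
  by rewrite -mulrBr; apply: M_mull.
by rewrite -mulrBl; apply: M_mulr.
Qed.

(* The quotient [O / M], carried by the indices of a transversal. *)
Definition residue_ring : Type := 'I_n.
HB.instance Definition _ := Finite.on residue_ring.

Let add (i j : residue_ring) : residue_ring := cls (e i + e j).
Let mul (i j : residue_ring) : residue_ring := cls (e i * e j).
Let opp (i : residue_ring) : residue_ring := cls (- e i).

Let cls_D x y : O x -> O y -> add (cls x) (cls y) = cls (x + y).
Proof.
by move=> Ox Oy; apply: cls_eq; [exact: O_D | exact: O_D | apply/M_sym/M_D; exact: clsP].
Qed.

Let cls_M x y : O x -> O y -> mul (cls x) (cls y) = cls (x * y).
Proof.
move=> Ox Oy; apply: cls_eq; [exact: OM | exact: OM |].
by apply/M_sym/M_M => //; exact: clsP.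
Qed.

Let add_assoc : associative add.
Proof. by move=> i j k; rewrite -[i]clsK -[j]clsK -[k]clsK !cls_D ?addrA //; apply: O_D. Qed.

Let add_comm : commutative add.
Proof. by move=> i j; rewrite /add addrC. Qed.

Let add_0 : left_id (cls 0) add.
Proof. by move=> i; rewrite -[i]clsK cls_D ?add0r //; apply: subgroup0. Qed.

Let add_N : left_inverse (cls 0) opp add.
Proof.
by move=> i; rewrite /opp -[X in add _ X]clsK cls_D ?addNr //; apply: subgroupN.
Qed.

HB.instance Definition _ :=
  GRing.isZmodule.Build residue_ring add_assoc add_comm add_0 add_N.

Let mul_assoc : associative mul.
Proof. by move=> i j k; rewrite -[i]clsK -[j]clsK -[k]clsK !cls_M ?mulrA //; apply: OM. Qed.

Let mul_1l : left_id (cls 1) mul.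
Proof. by move=> i; rewrite -[i]clsK cls_M ?mul1r. Qed.

Let mul_1r : right_id (cls 1) mul.
Proof. by move=> i; rewrite -[i]clsK cls_M ?mulr1. Qed.

Let mul_Dl : left_distributive mul add.
Proof.
move=> i j k; rewrite -[i]clsK -[j]clsK -[k]clsK.
by rewrite cls_D // !cls_M ?cls_D ?mulrDl //; by [apply: O_D | apply: OM].
Qed.

Let mul_Dr : right_distributive mul add.
Proof.
move=> i j k; rewrite -[i]clsK -[j]clsK -[k]clsK.
by rewrite cls_D // !cls_M ?cls_D ?mulrDr //; by [apply: O_D | apply: OM].
Qed.

Let one_neq0 : cls 1 != cls 0.
Proof.
apply/eqP => eq10; apply: M1; rewrite -[1]subr0.
apply: (subgroup_trans M_sub (clsP O1)); rewrite eq10; apply/M_sym/clsP.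
exact: subgroup0.
Qed.

HB.instance Definition _ := GRing.Zmodule_isNzRing.Build residue_ring
  mul_assoc mul_1l mul_1r mul_Dl mul_Dr one_neq0.

Let cls_eq0 x : O x -> (cls x == 0 :> residue_ring) = `[< M x >].
Proof.
move=> Ox; apply/eqP/asboolP => [cx0|Mx].
  rewrite -[x]subr0; apply: (subgroup_trans M_sub (clsP Ox)).
  by rewrite cx0; apply/M_sym/clsP/(subgroup0 O_sub).
by apply: cls_eq; rewrite ?subr0 //; apply: subgroup0.
Qed.

Fact residue_inv_ex (i : residue_ring) :
  exists j : residue_ring, i != 0 -> i * j = 1 /\ j * i = 1.
Proof.
have [->|i0] := eqVneq i 0; first by exists 0.
have [|y [Oy ey ye]] := O_unit (O_e i).
  by move=> Mi; have := cls_eq0 (O_e i); rewrite clsK (negPf i0) asboolT.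
exists (cls y) => _; rewrite -[i]clsK.
by split; apply: etrans (cls_M _ _) _ => //; rewrite ?ey ?ye.
Qed.

Let inv (i : residue_ring) : residue_ring :=
  if i == 0 then 0 else projT1 (cid (residue_inv_ex i)).

Let inv_P (i : residue_ring) : i != 0 -> i * inv i = 1 /\ inv i * i = 1.
Proof.
by move=> i0; rewrite /inv ifN //; apply: (projT2 (cid (residue_inv_ex i))).
Qed.

Let is_unit : pred residue_ring := fun i => i != 0.

Let mul_V : {in is_unit, left_inverse 1 inv *%R}.
Proof. by move=> i /inv_P[]. Qed.

Let mulV_ : {in is_unit, right_inverse 1 inv *%R}.
Proof. by move=> i /inv_P[]. Qed.

Let unit_P (i j : residue_ring) : j * i = 1 /\ i * j = 1 -> is_unit i.
Proof. by case=> _ ij; apply: contra_eq_neq ij => ->; rewrite mul0r eq_sym oner_neq0. Qed.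

Let inv_out : {in [predC is_unit], inv =1 id}.
Proof. by move=> i; rewrite !inE negbK => i0; rewrite /inv ifT // (eqP i0). Qed.

HB.instance Definition _ := GRing.NzRing_hasMulInverse.Build residue_ring
  mul_V mulV_ unit_P inv_out.

Lemma residue_ring_integral : GRing.integral_domain_axiom residue_ring.
Proof.
move=> i j ij0; apply/orP; have [|i0] := eqVneq i 0; first by left.
by right; rewrite -[j]mul1r -(inv_P i0).2 -mulrA ij0 mulr0.
Qed.

(* By Wedderburn's little theorem the residue ring is a field, hence its
   units form a cyclic group. *)
Lemma residue_generator : exists2 g, O g &
  forall x, O x -> M x \/ exists k, M (x - g ^+ k).
Proof.
pose k := FinDomainFieldType residue_ring_integral.
have /cyclicP[g gE] := field_unit_group_cyclic [set: {unit k}]%G.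
exists (e (val g : residue_ring)) => // x Ox.
have [Mx|NMx] := EM (M x); first by left.
right; have x0 : cls x != 0 :> residue_ring by rewrite cls_eq0 // asboolF.
have xU : (cls x : k) \is a GRing.unit by rewrite unitfE.
have : FinRing.unit k xU \in <[g]>%g by rewrite -gE inE.
case/cycleP => l gl; exists l.
have OX m : O (e (val g : residue_ring) ^+ m).
  by elim: m => [|m IHm]; rewrite ?expr0 // exprS; apply: OM.
have clsX m : cls (e (val g : residue_ring) ^+ m) = (val g : residue_ring) ^+ m.
  elim: m => [|m IHm]; first by rewrite !expr0.
  by rewrite !exprS -cls_M // clsK IHm.
apply: (subgroup_trans M_sub (clsP Ox)).
suff -> : cls x = cls (e (val g : residue_ring) ^+ l) by apply/M_sym/clsP.
rewrite clsX; have := congr1 val gl; rewrite /= FinRing.val_unitX => ->.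
by [].
Qed.

End ResidueRing.

(** * The maximal ideal of an order in a division algebra *)

Section DivisionOrder.
Variables (F : fieldType) (v : F -> int) (D : falgType F).
Variables (Delta : set D) (pi : D).
Hypotheses (v_disc : discrete_valuation v) (D_div : division D).
Hypotheses (Delta_order : is_order (valuation_ring v) Delta).
Hypothesis pi_unif : is_uniformizer Delta pi.

Let v_val : is_valuation v := discrete_is_valuation v_disc.

(** By [is_uniformizer], this is the set of non-units of [Delta] and also the left ideal generated
    by [pi]. *)
Definition uniformizer_ideal : set D := [set pi * x | x in Delta].
Local Notation M := uniformizer_ideal.

Lemma order_subgroup : subgroup Delta.
Proof.
have [D1 DB _ _ _] := Delta_order; split=> //.
by rewrite -(subrr 1); apply: DB.
Qed.

Lemma orderZ c x : val_ge v 0 c -> Delta x -> Delta (c *: x).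
Proof.
move=> c_ge0; have [_ _ _ [s ->] _] := Delta_order.
move=> [k [a [y [a_ge0 ys ->]]]]; exists k, (fun i => c * a i), y; split=> //.
  by move=> i; apply: (val_geMl v_val c_ge0 (a_ge0 i)).
by rewrite scaler_sumr; apply: eq_bigr => i _; rewrite scalerA.
Qed.

(* The powers of [t^-1] would make the finitely generated module [Delta]
   unbounded. *)
Lemma order_inv_scalar t : t != 0 -> 1 <= v t -> ~ Delta (t^-1)%:A.
Proof.
move=> t0 vt DtV; have [D1 _ DM [s sE] _] := Delta_order.
have DtX n : Delta (t^-1 ^+ n)%:A.
  elim: n => [|n IHn]; first by rewrite expr0 scale1r.
  by rewrite exprS -[_%:A]/(in_alg D _) rmorphM; apply: DM.
(* The linear form [f] is a coordinate that does not vanish at 1; its values on the generators bound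
   it below on [Delta]. *)
pose b := vbasis {: D}; have [i bi] : exists i, coord b i 1 != 0.
  apply: contrapT => /forallNP b0; case/eqP: (oner_neq0 D).
  rewrite (coord_vbasis (memvf 1)) big1 // => i _.
  by have /negP/negPn/eqP -> := b0 i; rewrite scale0r.
pose f := coord b i.
have [B fB] : exists B : nat, forall x, Delta x -> val_ge v (- B%:Z) (f x).
  have [B sB] : exists B : nat, {in s, forall y, val_ge v (- B%:Z) (f y)}.
    elim: (s) => [|y l [B lB]]; first by exists 0%N.
    exists (maxn B `|v (f y)|) => z; rewrite inE => /orP[/eqP ->|/lB].
      by move=> _; lia.
    by apply: val_geW; lia.
  exists B => x; rewrite sE => -[k [c [y [c_ge0 ys ->]]]].
  rewrite /f linear_sum; apply: (subgroup_sum (val_ge_subgroup v_val _)) => l _.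
  by rewrite linearZ /=; apply: (val_geMl v_val (c_ge0 l)); apply: sB; apply: ys.
(* The value of [f] at [(t^-1 ^+ n)%:A] has valuation [v (f 1) - n * v t], which is below [- B] for
   this [n]. *)
pose n := (B + `|v (f 1)|).+1.
have := fB _ (DtX n); rewrite /f linearZ /= /val_ge mulf_eq0 negb_or bi.
rewrite expf_neq0 ?invr_eq0 // => /(_ isT).
rewrite v_val.1 ?expf_neq0 ?invr_eq0 // (valX v_val) ?invr_eq0 // (valV v_val) //.
rewrite mulNrn lerNl opprD opprK -mulr_natr natz => vn.
have le_n : n%:Z <= v t * n%:Z by rewrite ler_peMl.
move: vn; set w := v (coord _ _ _) => vn; have nE : n = (B + `|w|).+1 by [].
by move: (v t * n%:Z) vn le_n nE => p; move: (n); lia.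
Qed.

(** A scalar of valuation 1 is a nonzero non-unit of [Delta], so the maximal ideal is not zero. *)
Lemma uniformizer_neq0 : pi != 0.
Proof.
have [t t0 vt] := val_surj v_disc; apply/eqP => pi0.
have [D1 _ _ _ _] := Delta_order; have [unif _] := pi_unif.
have : (Delta `\` [set x | [/\ x \is a GRing.unit, Delta x & Delta x^-1]]) (in_alg D t).
  split=> [|[_ _]]; first by apply: orderZ => // _; rewrite vt.
  by rewrite -fmorphV /=; apply: order_inv_scalar; rewrite ?vt.
rewrite unif => -[x _] /eqP; rewrite pi0 mul0r eq_sym fmorph_eq0.
by rewrite (negPf t0).
Qed.

Lemma uniformizer_unit : pi \is a GRing.unit.
Proof. exact/D_div/uniformizer_neq0. Qed.

Lemma uniformizer_idealE : M = [set x * pi | x in Delta].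
Proof. by have [unif <-] := pi_unif; rewrite unif. Qed.

Lemma ideal_sub x : M x -> Delta x.
Proof. by have [unif _] := pi_unif; rewrite /uniformizer_ideal -unif => -[]. Qed.

Lemma ideal_subgroup : subgroup M.
Proof.
have [D0 DB] := order_subgroup.
split=> [|_ _ [x Dx <-] [y Dy <-]]; first by exists 0; rewrite ?mulr0.
by exists (x - y); rewrite ?mulrBr //; apply: DB.
Qed.

Lemma ideal_mulr x y : M x -> Delta y -> M (x * y).
Proof.
have [_ _ DM _ _] := Delta_order.
by move=> [z Dz <-] Dy; exists (z * y); rewrite ?mulrA //; apply: DM.
Qed.

Lemma ideal_mull x y : Delta x -> M y -> M (x * y).
Proof.
have [_ _ DM _ _] := Delta_order; rewrite uniformizer_idealE.
by move=> Dx [z Dz <-]; exists (x * z); rewrite ?mulrA //; apply: DM.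
Qed.

Lemma ideal_proper : ~ M 1.
Proof.
have [unif _] := pi_unif; have [D1 _ _ _ _] := Delta_order.
by rewrite /uniformizer_ideal -unif => -[_]; apply; split; rewrite ?unitr1 ?invr1.
Qed.

Lemma order_unit x : Delta x -> ~ M x ->
  exists y, [/\ Delta y, x * y = 1 & y * x = 1].
Proof.
have [unif _] := pi_unif; rewrite /uniformizer_ideal -unif => Dx NMx.
have [xU _ DxV] : [/\ x \is a GRing.unit, Delta x & Delta x^-1].
  by apply: contrapT => NU; apply: NMx; split.
by exists x^-1; rewrite divrr ?mulVr.
Qed.

(** A nonzero scalar of positive valuation is a non-unit of [Delta], because its inverse lies
    outside [Delta]. *)
Lemma idealZ c x : val_ge v 1 c -> Delta x -> M (c *: x).
Proof.
move=> c_ge1 Dx; have [->|c0] := eqVneq c 0.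
  by rewrite scale0r; apply: subgroup0 ideal_subgroup.
rewrite -mulr_algl; apply: ideal_mulr => //.
have [D1 _ _ _ _] := Delta_order; have [unif _] := pi_unif; rewrite /uniformizer_ideal -unif.
split=> [|[_ _]].
  by apply: orderZ => //; apply: val_geW c_ge1.
by rewrite -[_%:A]/(in_alg D c) -fmorphV; apply: order_inv_scalar => //; apply: c_ge1.
Qed.

Lemma scale_ideal c x : val_ge v 0 c -> M x -> M (c *: x).
Proof.
move=> c_ge0 [y Dy <-]; exists (c *: y); first exact: orderZ.
by rewrite scalerAr.
Qed.

(** Conjugation by [pi] and by its inverse preserves [Delta] because [pi] generates the same ideal
    on the left and on the right. *)
Lemma order_conj (k : int) x : Delta x -> Delta (pi ^ k * x * pi ^ (- k)).
Proof.
have piU := uniformizer_unit.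
have conj1 y : Delta y -> Delta (pi * y * pi^-1).
  move=> Dy; have : M (pi * y) by exists y.
  by rewrite uniformizer_idealE => -[z Dz <-]; rewrite mulrK.
have conjV1 y : Delta y -> Delta (pi^-1 * y * pi).
  move=> Dy; have : M (y * pi) by rewrite uniformizer_idealE; exists y.
  by move=> [z Dz]; rewrite -mulrA => <-; rewrite mulKr.
have nat_conj n y : Delta y -> Delta (pi ^+ n * y * pi ^- n).
  move=> Dy; elim: n => [|n IHn]; first by rewrite expr0 invr1 mulr1 mul1r.
  by rewrite exprS invrM ?unitrX // !mulrA -(mulrA pi) -(mulrA pi); apply: conj1.
have nat_conjV n y : Delta y -> Delta (pi ^- n * y * pi ^+ n).
  move=> Dy; elim: n => [|n IHn]; first by rewrite expr0 invr1 mulr1 mul1r.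
  by rewrite exprSr invrM ?unitrX // !mulrA -(mulrA pi^-1) -(mulrA pi^-1); apply: conjV1.
move=> Dx; rewrite -invr_expz; case: k => n; first exact: nat_conj.
by rewrite NegzE -exprnN invrK; apply: nat_conjV.
Qed.

(** The [k - l] surplus factors [pi] stand in front of the conjugate of [x] by [pi ^ l], which is in
    [Delta]. *)
Lemma conj_ideal (k l : int) x : l < k -> Delta x ->
  M (pi ^ k * x * pi ^ (- l)).
Proof.
move=> lt_lk /(order_conj l) Dx.
have [n kE] : exists n : nat, k = n.+1%:Z + l by exists `|k - l|.-1; lia.
have piU := uniformizer_unit.
rewrite kE exprzDr //.
have piD : Delta pi by apply: ideal_sub; exists 1; rewrite ?mulr1 //; case: Delta_order.
have [D1 _ DM _ _] := Delta_order.
exists (pi ^+ n * (pi ^ l * x * pi ^ (- l))); last by rewrite -exprnP exprS !mulrA.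
by elim: n {kE} => [|n IHn]; rewrite ?expr0 ?mul1r // exprS -mulrA; apply: DM.
Qed.

(** Here [g] lifts a generator of the cyclic group of units of the finite residue ring. A linear
    relation between its powers up to [m], scaled to be primitive, stays nontrivial modulo the
    maximal ideal, so the powers below [m] suffice. *)
Lemma order_spanned_by_powers m n (T : 'I_n -> F) : central D ->
  \dim {: D} = (m ^ 2)%N -> covering (val_ge v 0) (val_ge v 1) T ->
  exists2 g, Delta g & residue_spans v Delta M (fun i : 'I_m => g ^+ i).
Proof.
move=> D_central D_dim T_cov; have [D1 DB DM _ _] := Delta_order.
have D_sub := order_subgroup; have M_sub := ideal_subgroup.
have [k [e [De [_ e_span]]]] :=
  residue_basis v_val M_sub scale_ideal idealZ.
have [l [t [t_cov t_pack]]] := covering_transversal M_sub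
  (residue_covering M_sub idealZ D_sub orderZ De e_span T_cov).
have [g Dg gP] := residue_generator D_sub D1 DM M_sub ideal_proper
  ideal_mull ideal_mulr order_unit t_cov t_pack.
exists g => //.
pose S x := exists (c : 'I_m -> F) (y : D),
  [/\ forall i, val_ge v 0 (c i), M y & x = \sum_i c i *: g ^+ i + y].
have S_M x : M x -> S x.
  move=> Mx; exists (fun=> 0), x; split=> // [i|]; first exact: val_ge0.
  by rewrite big1 ?add0r // => i _; rewrite scale0r.
have S_sub : subgroup S.
  split=> [|_ _ [c [y [c0 My ->]]] [d [z [d0 Mz ->]]]].
    exact/S_M/(subgroup0 M_sub).
  exists (fun i => c i - d i), (y - z); split=> [i||].
  - by apply: (subgroupB (val_ge_subgroup v_val 0)).
  - exact: (subgroupB M_sub).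
  - by under [in RHS]eq_bigr do rewrite scalerBl; rewrite sumrB opprD addrACA.
have SZ c x : val_ge v 0 c -> S x -> S (c *: x).
  move=> c_ge0 [d [y [d0 My ->]]]; exists (fun i => c * d i), (c *: y); split=> [i||].
  - exact: (val_geMl v_val).
  - exact: scale_ideal.
  - by rewrite scalerDr scaler_sumr; under eq_bigr do rewrite scalerA.
have [c' [c'0 rel']] := powers_dependent D_div D_central g D_dim.
have [a a0 [c_ge0 c_unit]] := primitive_scaling v_val c'0.
pose c i := a * c' i; have rel : \sum_i c i *: g ^+ i = 0.
  by under eq_bigr do rewrite -scalerA; rewrite -scaler_sumr rel' scaler0.
(* The last coefficient [c i0] which is a unit gives a recurrence expressing
   [g ^+ i0] modulo [M] in terms of lower powers. *)
have [i0 ci0 i0_max] : exists2 i0, ~ val_ge v 1 (c i0) &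
    forall i : 'I_m.+1, (i0 < i)%N -> val_ge v 1 (c i).
  have [i1 ci1] := c_unit.
  have Pi1 : `[< ~ val_ge v 1 (c i1) >] by apply/asboolP.
  case: (@arg_maxnP _ i1 (fun i => `[< ~ val_ge v 1 (c i) >]) (fun i => i) Pi1).
  move=> i0 /asboolP ci0 i0_max; exists i0 => // i lt_i; apply: contrapT => Nci.
  by have := i0_max i (asboolT Nci); rewrite /= leqNgt lt_i.
have [ci0_neq0 vci0] := not_val_ge1 (c_ge0 i0) ci0.
have DX k' : Delta (g ^+ k') by elim: k' => [|k' IH]; rewrite ?expr0 // exprS; apply: DM.
have S_pow k' : S (g ^+ k').
  elim/ltn_ind: k' => k' IHk; have [lt_km|le_mk] := ltnP k' m.
    exists (fun i => (i == Ordinal lt_km)%:R), 0; split=> [i||].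
    - by case: eqP => _; [exact: val_ge_1 | exact: val_ge0].
    - exact: subgroup0 M_sub.
    - rewrite addr0 (bigD1 (Ordinal lt_km)) //= eqxx scale1r big1 ?addr0 //.
      by move=> i /negPf ->; rewrite scale0r.
  have le_i0k : (i0 <= k')%N by apply: leq_trans le_mk; rewrite -ltnS.
  have -> : g ^+ k' = (c i0)^-1 *: (c i0 *: g ^+ k').
    by rewrite scalerA mulVf // scale1r.
  apply: (SZ); first exact: (val_ge0V v_val).
  have : c i0 *: g ^+ i0 = - \sum_(i | i != i0) c i *: g ^+ i.
    by apply/eqP; rewrite -addr_eq0; move: rel; rewrite (bigD1 i0) //= => ->.
  move=> /(congr1 (fun x => x * g ^+ (k' - i0))).
  rewrite -scalerAl -exprD subnKC // => ->; rewrite mulNr mulr_suml.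
  apply: (subgroupN S_sub); apply: (subgroup_sum S_sub) => i i_neq.
  rewrite -scalerAl -exprD; have [lt_i|lt_i|/val_inj eq_i] := ltngtP i i0.
  - by apply: SZ; [exact: c_ge0 | apply: IHk; lia].
  - by apply: S_M; apply: idealZ => //; apply: i0_max.
  - by rewrite eq_i eqxx in i_neq.
move=> x Dx; suff : S x.
  by move=> [d [y [d0 My ->]]]; exists d; split=> //; rewrite addrC addKr.
have [/S_M //|[k' Mx]] := gP x Dx.
by rewrite -(subrK (g ^+ k') x); apply: (subgroupD S_sub) => //; apply: S_M.
Qed.

End DivisionOrder.
(** * Vertices stable under the maximal order *)

Section Block.
Variables (F : fieldType) (v : F -> int) (D : falgType F).
Variables (Delta : set D) (pi : D) (m : nat).
Hypotheses (v_disc : discrete_valuation v) (D_div : division D).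
Hypotheses (D_central : central D) (D_dim : \dim {: D} = (m ^ 2)%N).
Hypotheses (Delta_order : is_order (valuation_ring v) Delta).
Hypothesis pi_unif : is_uniformizer Delta pi.
Hypothesis v_complete : forall s : nat -> F,
  (forall N : int, exists n0 : nat, forall p q : nat,
     (n0 <= p)%N -> (n0 <= q)%N -> val_ge v N (s p - s q)) ->
  exists l : F, forall N : int, exists n0 : nat, forall p : nat,
    (n0 <= p)%N -> val_ge v N (s p - l).
Hypothesis v_finite : exists n (T : 'I_n -> F),
  covering (val_ge v 0) (val_ge v 1) T.
Variables (E : fieldExtType F) (w : E -> int) (r : nat).
Hypotheses (w_val : is_valuation w) (w_ext : forall c, c != 0 -> w c%:A = v c).
Hypothesis E_dim : (r * m <= \dim {: E})%N.
Variable psi : {rmorphism E -> 'M[D]_r}.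
Hypothesis psi_Delta : forall x, val_ge w 0 x -> forall s u, Delta (psi x s u).

Local Notation M := (uniformizer_ideal Delta pi).

(* For [t0] maximizing [a], the entries [psi x s t0] with [a s = a t0]
   determine [x] modulo the maximal ideal, whereas the residue field of [E] has
   at least [q ^ (r * m)] elements and that of [Delta] at most [q ^ m]. *)
Lemma triangular_block_constant (a : 'I_r -> int) :
  (forall x, val_ge w 0 x -> forall s u, a u < a s -> M (psi x s u)) ->
  forall s t, a s = a t.
Proof.
move=> a_tri; have v_val := discrete_is_valuation v_disc.
have M_sub := ideal_subgroup pi Delta_order.
have [n [T0 T0_cov]] := v_finite.
have [q [T [T_cov T_pack]]] := covering_transversal (val_ge_subgroup v_val 1) T0_cov.
(* Comparing exponents of [q] requires [q > 1], which holds as 0 and 1 are incongruent. *)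
have q_gt1 : (1 < q)%N.
  have [[i i1] [j j1]] := (T_cov.2 1 (val_ge_1 v_val), T_cov.2 0 (val_ge0 _ _)).
  have v1sub := val_ge_subgroup v_val 1.
  rewrite ltnNge; apply/negP => le_q1; apply: (not_val_ge1_1 v_val).
  rewrite -[X in val_ge _ _ X]subr0; apply: (subgroup_trans v1sub i1).
  suff -> : i = j by apply: (subgroup_sym v1sub).
  by apply: val_inj; move: (ltn_ord i) (ltn_ord j) => /=; lia.
have m_gt0 : (0 < m)%N.
  by have := adim_gt0 {: D}%AS; rewrite D_dim; case: (m).
have [g Dg g_span] :=
  order_spanned_by_powers v_disc D_div Delta_order pi_unif D_central D_dim T_cov.
have DX k : Delta (g ^+ k).
  have [D1 _ DM _ _] := Delta_order.
  by elim: k => [|k IHk]; rewrite ?expr0 // exprS; apply: DM.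
pose b (h : {ffun 'I_m -> 'I_q}) := \sum_i T (h i) *: g ^+ i.
have b_cov : covering Delta M b.
  exact: (residue_covering M_sub (idealZ v_disc Delta_order pi_unif)
    (order_subgroup Delta_order) (orderZ v_disc Delta_order) _ g_span T_cov).
have [k [e [e_ge0 e_free e_span]]] := residue_basis_ext v_val w_val w_ext.
have le_dim_k := residue_spans_dim v_disc w_val w_ext v_complete e_ge0 e_span.
pose f (h : {ffun 'I_k -> 'I_q}) := \sum_i T (h i) *: e i.
have f_pack : packing (val_ge w 1) f by apply: residue_packing e_free T_cov.1 T_pack.
have f_ge0 h : val_ge w 0 (f h).
  apply: (subgroup_sum (val_ge_subgroup w_val 0)) => i _.
  by apply: (val_geZl w_val w_ext) => //; apply: T_cov.1.
suff main t0 : (forall s, a s <= a t0) -> forall s, a s = a t0.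
  move=> s t; have [t0 _ t0_max] := @arg_maxP _ _ _ s predT a isT.
  by rewrite (main t0) ?(main t0 _ t) // => u; apply: t0_max.
move=> t0_max s1; apply/eqP; apply: contraT => s1_neq.
pose S := {s : 'I_r | a s == a t0}.
have S_lt : (#|{: S}| < r)%N.
  rewrite card_sig -[X in (_ < X)%N]card_ord -(cardC (fun s => a s == a t0)).
  by rewrite -[X in (X < _)%N]addn0 ltn_add2l; apply/card_gt0P; exists s1.
have /choice[c cP] : forall hs : {ffun 'I_k -> 'I_q} * S,
    exists i, M (psi (f hs.1) (val hs.2) t0 - b i).
  by move=> [h s]; apply: b_cov.2; apply: psi_Delta.
(* [H h] records the residues of column [t0] of [psi (f h)] in the rows where [a] is maximal. It
   cannot be injective: it goes from a set of size [q ^ k], with [k >= r * m], to one of size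
   [q ^ (m * #|S|)], with [#|S| < r]. *)
pose H h : {ffun S -> {ffun 'I_m -> 'I_q}} := [ffun s => c (h, s)].
have /injectivePn[h [h' neq_hh' Hhh']] : ~~ injectiveb H.
  apply/negP => /injectiveP/leq_card.
  rewrite !card_ffun !card_ord -expnM leq_exp2l //.
  apply/negP; rewrite -ltnNge; apply: leq_trans le_dim_k; apply: leq_trans E_dim.
  by rewrite mulnC ltn_pmul2r.
pose z := f h - f h'.
have [z0 wz] : z != 0 /\ w z = 0.
  apply: not_val_ge1; first exact: (subgroupB (val_ge_subgroup w_val 0)).
  by move/f_pack/eqP; rewrite (negPf neq_hh').
have zV := val_ge0V w_val z0 wz.
have := congr1 (fun A : 'M_r => A t0 t0) (rmorphM psi z^-1 z).
rewrite mulVf // rmorph1 !mxE eqxx mulr1n => one_eq.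
case: (ideal_proper Delta_order pi_unif); rewrite one_eq.
(* In each term of the entry, one factor is in the ideal: that of [psi z] for [u] in [S], by the
   choice of [h] and [h'], and that of [psi z^-1] for other [u], by triangularity. *)
apply: (subgroup_sum M_sub) => u _; have [u_max|u_nmax] := boolP (a u == a t0).
  apply: (ideal_mull Delta_order pi_unif); first exact: psi_Delta.
  rewrite rmorphB !mxE; pose u' : S := Sub u u_max.
  apply: (subgroup_trans M_sub (cP (h, u'))).
  apply: (subgroup_sym M_sub).
  have <- : c (h', u') = c (h, u') by move/ffunP/(_ u'): Hhh'; rewrite !ffunE.
  exact: (cP (h', u')).
apply: (ideal_mulr Delta_order).
  by apply: a_tri => //; rewrite lt_neqAle u_nmax t0_max.
apply: psi_Delta; exact: (subgroupB (val_ge_subgroup w_val 0)).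
Qed.

End Block.

(** * Completions and their residue fields *)

Section Completion.
Variables (F E : fieldType) (v : F -> int) (u : E -> int).
Variable iota : {rmorphism F -> E}.
Hypothesis E_completion : is_completion v iota u.

Lemma completion_val_ge N x : val_ge u N (iota x) <-> val_ge v N x.
Proof.
rewrite /val_ge fmorph_eq0; have [_ ext _ _] := E_completion.
by split=> vx x0; move: (vx x0); rewrite ext.
Qed.

(** Density gives a [y] congruent to [x], and [y] is then integral because [x] is. *)
Lemma completion_approx x : val_ge u 0 x ->
  exists2 y, val_ge v 0 y & val_ge u 1 (x - iota y).
Proof.
have [u_disc _ dense _] := E_completion.
have u_val := discrete_is_valuation u_disc.
move=> x_ge0; have [y xy] := dense x 1; exists y => //.
apply/completion_val_ge; rewrite -[iota y](subKr x).
apply: (subgroupB (val_ge_subgroup u_val 0)) => //.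
exact: val_geW xy.
Qed.

Lemma completion_covering n (e : 'I_n -> F) : is_valuation v ->
  covering (val_ge v 0) (val_ge v 1) e ->
  covering (val_ge u 0) (val_ge u 1) (iota \o e).
Proof.
have [u_disc _ _ _] := E_completion.
have u_val := discrete_is_valuation u_disc.
move=> v_val [e_ge0 e_cov]; split=> [i|x /completion_approx[y /e_cov[i yi] xy]].
  exact/completion_val_ge.
exists i; apply: (subgroup_trans (val_ge_subgroup u_val 1) xy).
by rewrite -rmorphB; apply/completion_val_ge.
Qed.

End Completion.

(** Puts [L] directly over [rat], as the lemmas on places of number fields require. *)
Lemma number_field_tower_integral (K : fieldExtType rat) (L : fieldExtType K) (x : L) :
  integralOver (in_alg L \o in_alg K) x.
Proof.
have [p p_mon px0] := fieldExt_integral x.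
apply: (integral_root_monic _ px0); first exact: monic_map.
apply/integral_poly => i; rewrite coef_map.
by apply: integral_rmorph; apply: fieldExt_integral.
Qed.

(** * Entries of block-diagonal matrices and of vertex orders *)

Lemma mxdiag_Rank (V : nmodType) g (r : 'I_g -> nat) (A : forall i, 'M[V]_(r i)) i s t :
  (\mxdiag_i A i) (tagnat.Rank i s) (tagnat.Rank i t) = A i s t.
Proof. by rewrite -[RHS](congr1 (fun B : 'M_(r i) => B s t) (submxblock_diag A i)) !mxE. Qed.

Lemma mxdiag_off (V : nmodType) g (r : 'I_g -> nat) (A : forall i, 'M[V]_(r i)) k l :
  tagnat.sig1 k != tagnat.sig1 l -> (\mxdiag_i A i) k l = 0.
Proof. by move=> neq_kl; rewrite mxE (negPf neq_kl) mxE. Qed.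

Lemma vertex_order_entry (D : unitRingType) r (Delta : set D) (pi : D) (a : 'rV_r) A :
  vertex_order Delta pi a A -> forall s t,
  exists2 x, Delta x & A s t = pi ^ a 0 s * x * pi ^ (- a 0 t).
Proof.
move=> [X XD <-] s t; exists (X s t) => //.
by rewrite mul_mx_diag mul_diag_mx !mxE.
Qed.

Lemma mem_vertex_order (D : unitRingType) r (Delta : set D) (pi : D) (a : 'rV_r)
    (A : 'M_r) : pi \is a GRing.unit ->
  (forall s t, Delta (pi ^ (- a 0 s) * A s t * pi ^ a 0 t)) ->
  vertex_order Delta pi a A.
Proof.
move=> piU AD; exists (\matrix_(s, t) (pi ^ (- a 0 s) * A s t * pi ^ a 0 t)).
  by move=> s t; rewrite mxE.
apply/matrixP => s t; rewrite mul_mx_diag mul_diag_mx !mxE.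
by rewrite !mulrA -exprzDr // subrr expr0z mul1r -mulrA -exprzDr // subrr expr0z mulr1.
Qed.

Lemma homothety_class_refl r (a : 'rV[int]_r) : homothety_class a a.
Proof. by exists 0 => //; apply/matrixP => s t; rewrite !mxE addr0. Qed.

(** * The vertices whose order contains the integers of [L] *)

Theorem theorem2p1
  (K : fieldExtType rat) (n : nat)
  (B : falgType K) (B_central : central B) (B_simple : simple B)
  (B_dim : \dim {:B} = (n ^ 2)%N) (n_ge : (4 <= n ^ 2)%N)
  (L : fieldExtType K) (L_deg : \dim {:L} = n)
  (sigma : {lrmorphism L -> B})
  (R : set B) (R_max : maximal_order (@ring_of_integers K) R)
  (R_OL : sigma @` @ring_of_integers L `<=` R)
  (nu : K -> int) (nu_val : discrete_valuation nu)
  (Knu : fieldType) (iota : {rmorphism K -> Knu}) (vnu : Knu -> int)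
  (Knu_completion : is_completion nu iota vnu)
  (nu_unramified : unramified_in L nu)
  (g : nat) (P : 'I_g -> L -> int) (P_places : enumerates_places_above nu P)
  (LP : 'I_g -> fieldExtType Knu) (j : forall i, {rmorphism L -> LP i})
  (wP : forall i, LP i -> int)
  (LP_completion : forall i, is_completion (P i) (j i) (@wP i))
  (j_K : forall i (c : K), j i (c%:A) = (iota c)%:A)
  (LP_above : forall i, lies_above vnu (@wP i))
  (m : nat) (D : falgType Knu) (D_central : central D) (D_division : division D)
  (D_dim : \dim {:D} = (m ^ 2)%N)
  (nu_split_or_partial : m = 1%N \/ (1 < m < n)%N)
  (Delta : set D) (Delta_max : maximal_order (valuation_ring vnu) Delta)
  (pi : D) (pi_unif : is_uniformizer Delta pi)
  (phi : {rmorphism B -> 'M[D]_(\sum_(i < g) block_sizes LP m i)})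
  (phi_base_change : is_base_change iota phi)
  (phi_block : block_compatible vnu Delta sigma R wP j phi)
  (a : 'rV[int]_(\sum_(i < g) block_sizes LP m i)) :
  (phi \o sigma) @` @ring_of_integers L `<=` vertex_order Delta pi a
  <->
  exists l : 'I_g -> int,
    homothety_class a = homothety_class (\mxrow_(i < g) const_mx (l i)).
Proof.
have D_order := Delta_max.1.
have [vnu_disc vnu_iota _ vnu_complete] := Knu_completion.
have vnu_val := discrete_is_valuation vnu_disc.
have piU := uniformizer_unit vnu_disc D_division D_order pi_unif.
have [loc_R [psi [psi_scale phi_diag psi_Delta]]] := phi_block.
(* The integers of [L] lie in [R], whose image is contained in the matrices over [Delta]. *)
have OL_Delta b : @ring_of_integers L b -> forall s t, Delta (phi (sigma b) s t).
  move=> b_int s t; suff : matrices_over _ _ Delta (phi (sigma b)) by apply.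
  rewrite -loc_R; exists 1%N, (fun=> 1), (fun=> phi (sigma b)); split.
  - by move=> _; exists 1; [exact: val_ge_1 | rewrite /= scale1r].
  - by move=> _; exists (sigma b) => //; apply: R_OL; exists b.
  - by rewrite big_ord1 scale1r.
split; last first.
  move=> [l class_eq]; have := homothety_class_refl a.
  rewrite class_eq => -[c _ a_eq] _ [b b_int <-].
  (* The shift [c] is the same at all indices, so [a] itself is constant on blocks. *)
  have a_const k k' : tagnat.sig1 k = tagnat.sig1 k' -> a 0 k = a 0 k'.
    by rewrite -a_eq !mxE => ->.
  apply: mem_vertex_order => // s t /=.
  have [st|st] := eqVneq (tagnat.sig1 s) (tagnat.sig1 t).
    rewrite (a_const _ _ st) -{2}[a 0 t]opprK.
    by apply: (order_conj vnu_disc) => //; apply: OL_Delta.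
  rewrite phi_diag mxdiag_off // mulr0 mul0r.
  exact: subgroup0 (order_subgroup D_order).
move=> OL_vertex.
have nuE i : discrete_valuation (P i) /\ forall c, c != 0 -> P i c%:A = nu c.
  have [Pi_disc Pi_above] := let: And3 P_disc _ _ := P_places in P_disc i.
  split=> // c c0; have [_ ->] := nu_unramified _ Pi_disc Pi_above => //.
  by rewrite mul1r.
have wP_disc i : discrete_valuation (@wP i) by have [] := LP_completion i.
(* The index of [wP i] over [vnu] is read off at an element [k] of [K] with [nu k = 1]: there [wP i]
   agrees with [P i], hence with [nu] as [nu] is unramified. *)
have wPE i c : c != 0 -> wP i c%:A = vnu c.
  have [e [e_gt0 eE]] := LP_above i.
  have [k k0 nuk] := val_surj nu_val.
  have := eE (iota k); rewrite fmorph_eq0 => /(_ k0).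
  have [_ wP_ext _ _] := LP_completion i.
  rewrite -j_K wP_ext; last by rewrite -[k%:A]/(in_alg L k) fmorph_eq0.
  rewrite (nuE i).2 // vnu_iota // nuk mulr1 => e1 c0.
  by rewrite eE // -e1 mul1r.
have nu_isval := discrete_is_valuation nu_val.
have [n0 [T T_cov]] := number_field_residue_covering nu_val.
have vnu_finite : exists n (T : 'I_n -> Knu), covering (val_ge vnu 0) (val_ge vnu 1) T.
  by exists n0, (iota \o T); apply: completion_covering T_cov.
(* The integers of [L] map onto the residue field of [LP i]: [L] is dense in [LP i], and elements of
   [L] integral at [P i] are congruent to integers. *)
have approx_OL i x : val_ge (@wP i) 0 x ->
    exists2 b, @ring_of_integers L b & val_ge (@wP i) 1 (x - j i b).
  have [Pi_disc PiE] := nuE i; have Pi_val := discrete_is_valuation Pi_disc.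
  move=> /(completion_approx (LP_completion i))[y y_ge0 xy].
  have [n1 [S S_cov]] := residue_covering_ext nu_isval Pi_val PiE T_cov.
  have [b b_int yb] := integral_approx (f := in_alg L \o in_alg K)
    (@number_field_tower_integral K L) Pi_disc S_cov y_ge0.
  exists b => //; have wP_val := discrete_is_valuation (wP_disc i).
  apply: (subgroup_trans (val_ge_subgroup wP_val 1) xy).
  by rewrite -rmorphB; apply/(completion_val_ge (LP_completion i)).
have M_sub := ideal_subgroup pi D_order.
have psi_ge0 i x : val_ge (@wP i) 0 x -> forall s u, Delta (psi i x s u).
  by move=> x_ge0; apply: psi_Delta; exists x.
(* As the index is one, [x] is a uniformizer [t] of the base field times an integral element, and
   [psi] carries [t] to a scalar in the ideal. *)
have psi_ge1 i x s u : val_ge (@wP i) 1 x -> uniformizer_ideal Delta pi (psi i x s u).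
  move=> x_ge1; have [t t0 vt] := val_surj vnu_disc.
  have wP_val := discrete_is_valuation (wP_disc i).
  rewrite -[x](scalerK t0) scalerA mulrC -scalerA psi_scale mxE mulr_algl.
  apply: (idealZ vnu_disc) => //; first by move=> _; rewrite vt.
  apply: psi_ge0; rewrite -[0](addNr 1).
  by apply: (val_geZ wP_val (wPE i)) => // _; rewrite valV // vt.
have a_const i (s t : 'I_(block_sizes LP m i)) :
    a 0 (tagnat.Rank i s) = a 0 (tagnat.Rank i t).
  apply: (triangular_block_constant vnu_disc D_division D_central D_dim D_order
    pi_unif vnu_complete vnu_finite (discrete_is_valuation (wP_disc i))
    (wPE i) _ (psi_ge0 i) (a := fun s => a 0 (tagnat.Rank i s))).
    exact: leq_trunc_div.
  move=> x /(approx_OL i)[b b_int xb] {}s u lt_us.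
  (* Up to the ideal, [x] may be replaced by an integer [b] of [L], whose entry is
     [pi ^ a_s * y * pi ^ (- a_u)] with [a_u < a_s]. *)
  rewrite -(subrK (j i b) x) rmorphD mxE; apply: (subgroupD M_sub).
    exact: psi_ge1.
  have /vertex_order_entry/(_ (tagnat.Rank i s) (tagnat.Rank i u))[y Dy] :
      vertex_order Delta pi a (phi (sigma b)) by apply: OL_vertex; exists b.
  by rewrite phi_diag mxdiag_Rank => ->; apply: (conj_ideal vnu_disc).
(* The common value of [a] on block [i]. The default 0 serves empty blocks and is never read at an
   index [k], which lies in its own block. *)
pose l i := if [pick s : 'I_(block_sizes LP m i)] is Some s
  then a 0 (tagnat.Rank i s) else 0.
exists l; congr homothety_class; apply/rowP => k; rewrite !mxE -{1}[k]tagnat.sig2K /l.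
by case: pickP => [s _|/(_ (tagnat.sig2 k)) //]; apply: a_const.
Qed.
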